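(* Let $G=G_1\ast G_2\ast G_3\ast G_4$ be a free splitting of a group $G$ where each $G_i$ is non-trivial. Then $\mathrm{Out}(G;G_1,G_2,G_3,G_4)$ is generated by the twelve groups $G_{i_j}$ for $i,j\in\{1,2,3,4\}$ distinct and $\Phi=\prod_{k=1}^4\mathrm{Aut}(G_k)$, subject to the relations: 1. $[f_{i_j}(g),f_{i_k}(h)]=1$ for all $g,h\in G_i$; 2. $[f_{i_j}(g),f_{k_l}(h)]=1$ for all $g\in G_i$, $h\in G_k$; 3. $f_{i_j}(g)f_{i_k}(g)f_{i_l}(g)=\mathrm{Ad}_{G_i}(g)$ for all $g\in G_i$; 4. $\varphi^{-1}f_{i_j}(g)\varphi=f_{i_j}(\varphi(g))$ for all $g\in G_i$ and all $\varphi\in\Phi$; where in each relation $i,j,k,l$ range over all choices with $\{i,j,k,l\}=\{1,2,3,4\}$.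
   Context: $\mathrm{Out}(G;G_1,\dots,G_n)$ is the group of pure symmetric outer automorphisms of the splitting: the subgroup of $\mathrm{Out}(G)$ of those classes having a representative $\psi\in\mathrm{Aut}(G)$ such that for each $i$ there is $g_i\in G$ with $\psi(G_i)=g_i^{-1}G_ig_i$. Automorphisms act on the right, so a product $\psi\chi$ means first $\psi$, then $\chi$. For $i\neq j$, $f_{i_j}(g)$ ($g\in G_i$) is the class of the automorphism of $G$ which sends each $x\in G_j$ to $gxg^{-1}$ and fixes every $G_k$ with $k\ne j$ pointwise; $G_{i_j}=\{f_{i_j}(g):g\in G_i\}$, and $f_{i_j}:G_i\to G_{i_j}$ is an isomorphism. $\Phi$ is identified with the group of (classes of) factor automorphisms, i.e. those $\varphi\in\mathrm{Aut}(G)$ restricting to an automorphism of each $G_i$. $\mathrm{Ad}_{G_i}(g)\in\Phi$ is the automorphism acting as $x\mapsto g^{-1}xg$ on $G_i$ and trivially on $G_k$, $k\neq i$. ''Generated by groups $K_1,\dots,K_r$ subject to relations $R$'' means: the natural homomorphism from the quotient of the free product $K_1\ast\dots\ast K_r$ by the normal closure of $R$ is an isomorphism onto the group in question. *)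

(* Defs.v *)
From HB Require Import structures.
From mathcomp Require Import all_boot.
From mathcomp Require Import generic_quotient.
From mathcomp Require Import boolp classical_sets.

Set Implicit Arguments.
Unset Strict Implicit.
Unset Printing Implicit Defensive.

Local Open Scope group_scope.
Local Open Scope quotient_scope.

(* A groupType is a possibly infinite group whose carrier has choice          *)
(* operators; under the classical axioms of boolp every group carries them.   *)

Notation "{ 'hom' G -> H }" := (UMagmaMorphism.type G%type H%type)
  (at level 0, G at level 98, H at level 99, format "{ 'hom'  G  ->  H }")
  : type_scope.

Lemma homV (G H : groupType) (f : {hom G -> H}) x : f x^-1 = (f x)^-1.
Proof. by apply: (mulgI (f x)); rewrite -gmulfM !mulgV gmulf1. Qed.

Record subgp (G : groupType) (S : groupClosed G) :=
  Subgp { subgp_val : G; subgp_valP : subgp_val \in S }.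

HB.instance Definition _ (G : groupType) (S : groupClosed G) :=
  [isSub for @subgp_val G S].
HB.instance Definition _ (G : groupType) (S : groupClosed G) :=
  [Choice of subgp S by <:].

Lemma gpred_closed (G : groupType) (S : groupClosed G) : group_closed S.
Proof. by split; [apply: gpred1 | apply: gpredF]. Qed.

HB.instance Definition _ (G : groupType) (S : groupClosed G) :=
  SubChoice_isSubGroup.Build G _ (subgp S) (gpred_closed S).

Definition incl (G : groupType) (S : groupClosed G) : {hom subgp S -> G} :=
  (val : subgp S -> G).

Lemma subgpM (G : groupType) (S : groupClosed G) (x y : subgp S) :
  val (x * y) = val x * val y.
Proof. exact: valM. Qed.
Lemma subgpV (G : groupType) (S : groupClosed G) (x : subgp S) :
  val x^-1 = (val x)^-1.
Proof. by apply: (mulgI (val x)); rewrite -subgpM !mulgV. Qed.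

HB.mixin Record isConjgClosed (G : groupType) (S : {pred G}) := {
  gpredJ : forall x y : G, x \in S -> x ^ y \in S
}.

#[short(type="normalClosed")]
HB.structure Definition NormalClosed (G : groupType) :=
  {S of GroupClosed G S & isConjgClosed G S}.

Section Quotient.
Variables (G : groupType) (N : normalClosed G).

Definition modN (x y : G) : bool := x / y \in N.

Lemma modN_equiv : equiv_class_of modN.
Proof.
split=> [x|x y|y x z]; rewrite /modN.
- by rewrite mulgV gpred1.
- by rewrite -(gpredV N (x / y)) invgM invgK.
- move=> xy yz; rewrite -[x](mulgVK y) -mulgA.
  exact: gpredM.
Qed.

Canonical modN_rel := EquivRelPack modN_equiv.

Definition quot := {eq_quot modN_rel}.

HB.instance Definition _ := Choice.on quot.
HB.instance Definition _ := EqQuotient.on quot.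

Lemma eq_quotP (x y : G) : \pi_quot x = \pi_quot y <-> x / y \in N.
Proof. by split=> [/eqmodP|H]; last exact/eqmodP. Qed.

Definition quot_one : quot := \pi_quot 1.
Definition quot_inv (a : quot) : quot := \pi_quot (repr a)^-1.
Definition quot_mul (a b : quot) : quot := \pi_quot (repr a * repr b).

Lemma quot_mulE x y : quot_mul (\pi_quot x) (\pi_quot y) = \pi_quot (x * y).
Proof.
apply/eq_quotP; case: piP => x' /eq_quotP xx'; case: piP => y' /eq_quotP yy'.
have -> : x' * y' / (x * y) = (x' / x) * (y' / y) ^ x^-1.
  by rewrite /conjg invgM invgK !mulgA mulgVK.
by rewrite gpredM ?gpredJ// -gpredV invgM invgK.
Qed.

Lemma quot_invE x : quot_inv (\pi_quot x) = \pi_quot x^-1.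
Proof.
apply/eq_quotP; case: piP => x' /eq_quotP xx'; rewrite invgK.
have -> : x'^-1 * x = (x / x') ^ x' by rewrite /conjg -!mulgA mulVg mulg1.
exact: gpredJ.
Qed.

Lemma quot_mulA : associative quot_mul.
Proof.
move=> a b c; rewrite -[a]reprK -[b]reprK -[c]reprK.
rewrite (quot_mulE (repr b)) !(quot_mulE (repr a)).
by rewrite quot_mulE mulgA.
Qed.
Lemma quot_mul1 : left_id quot_one quot_mul.
Proof. by move=> a; rewrite -[a]reprK quot_mulE mul1g. Qed.
Lemma quot_1mul : right_id quot_one quot_mul.
Proof. by move=> a; rewrite -[a]reprK quot_mulE mulg1. Qed.
Lemma quot_mulV : left_inverse quot_one quot_inv quot_mul.
Proof. by move=> a; rewrite -[a]reprK quot_invE quot_mulE mulVg. Qed.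
Lemma quot_Vmul : right_inverse quot_one quot_inv quot_mul.
Proof. by move=> a; rewrite -[a]reprK quot_invE quot_mulE mulgV. Qed.

HB.instance Definition _ := isGroup.Build quot
  quot_mulA quot_mul1 quot_1mul quot_mulV quot_Vmul.

Definition quot_pi (x : G) : quot := \pi_quot x.

Lemma quot_piF : {morph quot_pi : x y / x / y}.
Proof. by move=> x y; rewrite /quot_pi -quot_mulE -quot_invE. Qed.

HB.instance Definition _ := isGroupMorphism.Build G quot quot_pi quot_piF.

End Quotient.

Inductive ncl_mem (G : groupType) (R : G -> Prop) : G -> Prop :=
| ncl_gen x : R x -> ncl_mem R x
| ncl_one : ncl_mem R 1
| ncl_mul x y : ncl_mem R x -> ncl_mem R y -> ncl_mem R (x * y)
| ncl_inv x : ncl_mem R x -> ncl_mem R x^-1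
| ncl_conj x y : ncl_mem R x -> ncl_mem R (x ^ y).

Definition ncl (G : groupType) (R : G -> Prop) : {pred G} :=
  fun x => `[< ncl_mem R x >].

Section NclClosed.
Variables (G : groupType) (R : G -> Prop).

Lemma nclM : mulg_closed (ncl R).
Proof. by move=> x y /asboolP Rx /asboolP Ry; apply/asboolP/ncl_mul. Qed.
Lemma ncl1 : 1 \in ncl R.
Proof. exact/asboolP/ncl_one. Qed.
Lemma nclV : invg_closed (ncl R).
Proof. by move=> x /asboolP Rx; apply/asboolP/ncl_inv. Qed.
Lemma nclJ x y : x \in ncl R -> x ^ y \in ncl R.
Proof. by move=> /asboolP Rx; apply/asboolP/ncl_conj. Qed.

HB.instance Definition _ := isMulClosed.Build G (ncl R) nclM.
HB.instance Definition _ := isMul1Closed.Build G (ncl R) ncl1.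
HB.instance Definition _ := isInvClosed.Build G (ncl R) nclV.
HB.instance Definition _ := isConjgClosed.Build G (ncl R) nclJ.

End NclClosed.

Section FreeProduct.
Variables (I : choiceType) (K : I -> groupType).

Definition fword := seq {i : I & K i}.

Definition letter i (x : K i) : {i : I & K i} := Tagged (fun i => K i) x.

(* The free product is the quotient of the monoid of words with letters in    *)
(* the [K i] by the congruence that multiplies adjacent letters of the same   *)
(* factor and deletes trivial letters.                                        *)
Inductive fword_eq : fword -> fword -> Prop :=
| fword_merge u v i (x y : K i) :
    fword_eq (u ++ [:: letter x, letter y & v]) (u ++ letter (x * y) :: v)
| fword_unit u v i : fword_eq (u ++ letter (1 : K i) :: v) (u ++ v)
| fword_refl u : fword_eq u u
| fword_sym u v : fword_eq u v -> fword_eq v u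
| fword_trans u v w : fword_eq u v -> fword_eq v w -> fword_eq u w.

Definition fword_eqb (u v : fword) : bool := `[< fword_eq u v >].

Lemma fword_equiv : equiv_class_of fword_eqb.
Proof.
split=> [u|u v|v u w].
- exact/asboolP/fword_refl.
- by apply/asboolP/asboolP; apply: fword_sym.
- by move=> /asboolP uv /asboolP vw; apply/asboolP/(fword_trans uv).
Qed.

Canonical fword_rel := EquivRelPack fword_equiv.

Definition fprodg := {eq_quot fword_rel}.

HB.instance Definition _ := Choice.on fprodg.
HB.instance Definition _ := EqQuotient.on fprodg.

Lemma fprodgP u v : \pi_fprodg u = \pi_fprodg v <-> fword_eq u v.
Proof.
by split=> [/eqmodP/asboolP|H]; last exact/eqmodP/asboolP.
Qed.

Definition fword_inv (u : fword) : fword :=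
  rev [seq letter ((tagged p)^-1 : K (tag p)) | p <- u].

Lemma fword_eq_cat2l w u v : fword_eq u v -> fword_eq (w ++ u) (w ++ v).
Proof.
elim=> {u v} [u v i x y|u v i|u|u v _|u v t _ uv _ vt].
- by rewrite !catA; apply: fword_merge.
- by rewrite !catA; apply: fword_unit.
- exact: fword_refl.
- exact: fword_sym.
- exact: fword_trans uv vt.
Qed.

Lemma fword_eq_cat2r w u v : fword_eq u v -> fword_eq (u ++ w) (v ++ w).
Proof.
elim=> {u v} [u v i x y|u v i|u|u v _|u v t _ uv _ vt].
- by rewrite -!catA; apply: fword_merge.
- by rewrite -!catA; apply: fword_unit.
- exact: fword_refl.
- exact: fword_sym.
- exact: fword_trans uv vt.
Qed.

Lemma fword_eq_cat u u' v v' :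
  fword_eq u u' -> fword_eq v v' -> fword_eq (u ++ v) (u' ++ v').
Proof.
move=> uu' vv'; apply: fword_trans (fword_eq_cat2r v uu') _.
exact: fword_eq_cat2l.
Qed.

Lemma fword_inv_cat u v : fword_inv (u ++ v) = fword_inv v ++ fword_inv u.
Proof. by rewrite /fword_inv map_cat rev_cat. Qed.

Lemma fword_eq_inv u v : fword_eq u v -> fword_eq (fword_inv u) (fword_inv v).
Proof.
elim=> {u v} [u v i x y|u v i|u|u v _|u v t _ uv _ vt].
- rewrite -cat_rcons -cats1 -catA !fword_inv_cat /fword_inv /= !rev_cons -!cats1.
  rewrite -!catA invgM; exact: fword_merge.
- rewrite !fword_inv_cat /fword_inv /= rev_cons -cats1 -catA /= invg1.
  exact: fword_unit.
- exact: fword_refl.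
- exact: fword_sym.
- exact: fword_trans uv vt.
Qed.

Lemma fword_inv_catl u : fword_eq (fword_inv u ++ u) [::].
Proof.
elim: u => [|[i x] u IHu]; first exact: fword_refl.
rewrite -cat1s fword_inv_cat -!catA [fword_inv [:: _]]/= /fword_inv /=.
apply: fword_trans IHu; apply: fword_eq_cat2l.
apply: fword_trans (@fword_merge [::] u i x^-1 x) _; rewrite mulVg.
exact: (@fword_unit [::] u i).
Qed.

Lemma fword_invK : involutive fword_inv.
Proof.
move=> u; rewrite /fword_inv map_rev revK -map_comp -[RHS]map_id.
by apply: eq_map => -[i x] /=; rewrite invgK.
Qed.

Definition fprodg_one : fprodg := \pi_fprodg [::].
Definition fprodg_inv (a : fprodg) : fprodg := \pi_fprodg (fword_inv (repr a)).
Definition fprodg_mul (a b : fprodg) : fprodg := \pi_fprodg (repr a ++ repr b).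

Lemma fprodg_mulE u v : fprodg_mul (\pi_fprodg u) (\pi_fprodg v) =
  \pi_fprodg (u ++ v).
Proof.
apply/fprodgP; case: piP => u' /fprodgP uu'; case: piP => v' /fprodgP vv'.
by apply: fword_eq_cat; apply: fword_sym.
Qed.

Lemma fprodg_invE u : fprodg_inv (\pi_fprodg u) = \pi_fprodg (fword_inv u).
Proof.
apply/fprodgP; case: piP => u' /fprodgP uu'.
by apply: fword_eq_inv; apply: fword_sym.
Qed.

Lemma fprodg_mulA : associative fprodg_mul.
Proof.
move=> a b c; rewrite -[a]reprK -[b]reprK -[c]reprK.
rewrite (fprodg_mulE (repr b)) !(fprodg_mulE (repr a)).
by rewrite fprodg_mulE catA.
Qed.
Lemma fprodg_mul1 : left_id fprodg_one fprodg_mul.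
Proof. by move=> a; rewrite -[a]reprK fprodg_mulE. Qed.
Lemma fprodg_1mul : right_id fprodg_one fprodg_mul.
Proof. by move=> a; rewrite -[a]reprK fprodg_mulE cats0. Qed.
Lemma fprodg_mulV : left_inverse fprodg_one fprodg_inv fprodg_mul.
Proof.
move=> a; rewrite -[a]reprK fprodg_invE fprodg_mulE.
exact/fprodgP/fword_inv_catl.
Qed.
Lemma fprodg_Vmul : right_inverse fprodg_one fprodg_inv fprodg_mul.
Proof.
move=> a; rewrite -[a]reprK fprodg_invE fprodg_mulE; apply/fprodgP.
by rewrite -{1}[repr a]fword_invK; apply: fword_inv_catl.
Qed.

HB.instance Definition _ := isGroup.Build fprodg
  fprodg_mulA fprodg_mul1 fprodg_1mul fprodg_mulV fprodg_Vmul.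

Definition fprodg_in i (x : K i) : fprodg := \pi_fprodg [:: letter x].

Lemma fprodg_in_morph i : monoid_morphism (@fprodg_in i).
Proof.
split=> [|x y]; first exact/fprodgP/(@fword_unit [::] [::]).
rewrite [RHS]fprodg_mulE; apply/fprodgP/fword_sym.
exact: (@fword_merge [::] [::]).
Qed.

HB.instance Definition _ i :=
  isUMagmaMorphism.Build (K i) fprodg (@fprodg_in i) (fprodg_in_morph i).

Section Lift.
Variables (H : groupType) (f : forall i, {hom K i -> H}).

Definition fword_eval (u : fword) : H := \prod_(p <- u) f (tag p) (tagged p).

Definition fprodg_lift (a : fprodg) : H := fword_eval (repr a).

Lemma fword_eval_eq u v : fword_eq u v -> fword_eval u = fword_eval v.
Proof.
elim=> {u v} [u v i x y|u v i|//|//|u v t _ -> _ -> //].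
- by rewrite /fword_eval !big_cat !big_cons /= gmulfM !mulgA.
- by rewrite /fword_eval !big_cat !big_cons /= gmulf1 mul1g.
Qed.

Lemma fprodg_liftE u : fprodg_lift (\pi_fprodg u) = fword_eval u.
Proof.
by rewrite /fprodg_lift; case: piP => u' /fprodgP /fword_eval_eq ->.
Qed.

Lemma fprodg_lift_morph : monoid_morphism fprodg_lift.
Proof.
split=> [|]; first by rewrite fprodg_liftE /fword_eval big_nil.
move=> a b; rewrite -[a]reprK -[b]reprK.
rewrite [X in fprodg_lift X]fprodg_mulE !fprodg_liftE.
by rewrite /fword_eval big_cat.
Qed.

HB.instance Definition _ :=
  isUMagmaMorphism.Build fprodg H fprodg_lift fprodg_lift_morph.

Lemma fprodg_lift_in i (x : K i) : fprodg_lift (fprodg_in x) = f i x.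
Proof. by rewrite fprodg_liftE /fword_eval big_seq1. Qed.

End Lift.

Lemma fprodg_hom_eq (H : groupType) (f g : {hom fprodg -> H}) :
  (forall i (x : K i), f (fprodg_in x) = g (fprodg_in x)) -> f =1 g.
Proof.
move=> fg a; rewrite -[a]reprK; elim: (repr a) => [|[i x] u IHu].
  by rewrite !gmulf1.
have -> :
  \pi_fprodg (Tagged (fun i => K i) x :: u) = fprodg_in x * \pi_fprodg u.
  by rewrite [RHS]fprodg_mulE.
by rewrite !gmulfM fg IHu.
Qed.

End FreeProduct.

(* The relations are [w = 1] for [w] in [R]; [h] is the natural homomorphism   *)
(* to [H] from the quotient of the free product by the normal closure of [R]. *)
Definition generated_subject_to (I : choiceType) (K : I -> groupType)
    (H : groupType) (f : forall i, {hom K i -> H}) (R : fprodg K -> Prop) :=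
  exists h : {hom quot (ncl R) -> H},
    (forall w : fprodg K, h (quot_pi (ncl R) w) = fprodg_lift f w)
    /\ bijective h.

(* The inverse is kept as data, and is determined by [aut_fun]: see [aut_eq].  *)
Record aut (G : groupType) := Aut {
  aut_fun :> G -> G;
  aut_inv : G -> G;
  aut_funM : {morph aut_fun : x y / x * y};
  aut_funK : cancel aut_fun aut_inv;
  aut_invK : cancel aut_inv aut_fun
}.

HB.instance Definition _ G := gen_eqMixin (aut G).
HB.instance Definition _ G := gen_choiceMixin (aut G).

Section Aut.
Variable G : groupType.
Implicit Types a b c : aut G.

Lemma aut_eq a b : a =1 b -> a = b.
Proof.
case: a b => [a a' aM aK a'K] [b b' bM bK b'K] /= ab.
have {}ab : a = b by apply/funext.
subst b; have eab : a' = b'.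
  by apply/funext => x; rewrite -{1}[x]b'K aK.
by subst b'; congr Aut; apply: Prop_irrelevance.
Qed.

Lemma aut_morph a : monoid_morphism a.
Proof.
split; last exact: aut_funM.
by apply: (mulgI (a 1)); rewrite -aut_funM !mulg1.
Qed.

HB.instance Definition _ a := isUMagmaMorphism.Build G G a (aut_morph a).

Definition aut_one : aut G :=
  @Aut G idfun idfun (fun _ _ => erefl) (frefl _) (frefl _).

Lemma aut_inv_subproof a : {morph aut_inv a : x y / x * y}.
Proof.
by move=> x y; apply: (can_inj (aut_funK a)); rewrite aut_funM !aut_invK.
Qed.

Definition aut_V a : aut G :=
  Aut (@aut_inv_subproof a) (@aut_invK _ a) (@aut_funK _ a).

Lemma aut_mul_subproof a b : {morph b \o a : x y / x * y}.
Proof. by move=> x y; rewrite /= !gmulfM. Qed.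

(* Automorphisms act on the right: [a * b] is [a] followed by [b].            *)
Definition aut_mul a b : aut G :=
  Aut (@aut_mul_subproof a b)
    (can_comp (@aut_funK _ b) (@aut_funK _ a))
    (can_comp (@aut_invK _ a) (@aut_invK _ b)).

Lemma aut_mulA : associative aut_mul.
Proof. by move=> a b c; apply: aut_eq. Qed.
Lemma aut_mul1 : left_id aut_one aut_mul.
Proof. by move=> a; apply: aut_eq. Qed.
Lemma aut_1mul : right_id aut_one aut_mul.
Proof. by move=> a; apply: aut_eq. Qed.
Lemma aut_mulV : left_inverse aut_one aut_V aut_mul.
Proof. by move=> a; apply: aut_eq => x; apply: aut_invK. Qed.
Lemma aut_Vmul : right_inverse aut_one aut_V aut_mul.
Proof. by move=> a; apply: aut_eq => x; apply: aut_funK. Qed.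

HB.instance Definition _ := isGroup.Build (aut G)
  aut_mulA aut_mul1 aut_1mul aut_mulV aut_Vmul.

Lemma autME a b x : (a * b) x = b (a x). Proof. by []. Qed.
Lemma aut1E x : (1 : aut G) x = x. Proof. by []. Qed.
Lemma autK a x : a^-1 (a x) = x. Proof. exact: aut_funK. Qed.
Lemma autVK a x : a (a^-1 x) = x. Proof. exact: aut_invK. Qed.
Lemma aut_funV a x : a x^-1 = (a x)^-1. Proof. exact: homV. Qed.
Lemma autJ a x y : a (x ^ y) = a x ^ a y.
Proof. by rewrite /conjg !aut_funM aut_funV. Qed.

Definition inner (g : G) : aut G :=
  @Aut G (fun x => x ^ g) (fun x => x ^ g^-1) (fun x y => conjMg x y g)
    (conjgK g) (conjgKV g).

Lemma inner_morph : monoid_morphism inner.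
Proof.
by split=> [|g h]; apply: aut_eq => x /=; rewrite ?conjg1 ?conjgM.
Qed.

HB.instance Definition _ := isUMagmaMorphism.Build G (aut G) inner inner_morph.

Lemma innerJ g a : inner g ^ a = inner (a g).
Proof.
by apply: aut_eq => x; rewrite /conjg !autME -[inner g _]/(_ ^ g) autJ autVK.
Qed.

Definition Inn : {pred aut G} := fun a => `[< exists g, a = inner g >].

Lemma InnM : mulg_closed Inn.
Proof.
move=> _ _ /asboolP[g ->] /asboolP[h ->]; apply/asboolP.
by exists (g * h); rewrite gmulfM.
Qed.
Lemma Inn1 : 1 \in Inn.
Proof. by apply/asboolP; exists 1; rewrite gmulf1. Qed.
Lemma InnV : invg_closed Inn.
Proof.
by move=> _ /asboolP[g ->]; apply/asboolP; exists g^-1; rewrite homV.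
Qed.
Lemma InnJ a b : a \in Inn -> a ^ b \in Inn.
Proof.
by move=> /asboolP[g ->]; apply/asboolP; exists (b g); rewrite innerJ.
Qed.

HB.instance Definition _ := isMulClosed.Build (aut G) Inn InnM.
HB.instance Definition _ := isMul1Closed.Build (aut G) Inn Inn1.
HB.instance Definition _ := isInvClosed.Build (aut G) Inn InnV.
HB.instance Definition _ := isConjgClosed.Build (aut G) Inn InnJ.

Definition Out := quot Inn.

HB.instance Definition _ := Group.on Out.

End Aut.

Arguments Inn : clear implicits.

Definition out_class (G : groupType) (a : aut G) : Out G := quot_pi (Inn G) a.

HB.instance Definition _ (G : groupType) :=
  UMagmaMorphism.copy (@out_class G) (quot_pi (Inn G)).

Section PureSymmetric.
Variables (G : groupType) (I : Type) (Gs : I -> groupClosed G).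

Definition preserves_conj_classes (a : aut G) : Prop :=
  forall i, exists g : G,
    (a @` [set` Gs i] = (fun x => x ^ g) @` [set` Gs i])%classic.

Definition pure_sym : {pred Out G} :=
  fun c => `[< exists2 a, out_class a = c & preserves_conj_classes a >].

Lemma pure_symM : mulg_closed pure_sym.
Proof.
move=> _ _ /asboolP[a <- aP] /asboolP[b <- bP]; apply/asboolP.
exists (a * b); first by rewrite gmulfM.
move=> i; have [g ag] := aP i; have [h bh] := bP i.
exists (h * b g); apply/seteqP; split=> _ [x xG <-].
  have : (a @` [set` Gs i])%classic (a x) by exists x.
  rewrite ag autME => -[y yG <-].
  have : (b @` [set` Gs i])%classic (b y) by exists y.
  rewrite bh => -[z zG bz]; exists z => //.
  by rewrite autJ -bz conjgM.
have : ((fun x => x ^ h) @` [set` Gs i])%classic (x ^ h) by exists x.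
rewrite -bh => -[y yG bz].
have : ((fun x => x ^ g) @` [set` Gs i])%classic (y ^ g) by exists y.
rewrite -ag => -[z zG az]; exists z => //=.
by rewrite conjgM -bz az autJ.
Qed.

Lemma pure_sym1 : 1 \in pure_sym.
Proof.
apply/asboolP; exists 1; first by rewrite gmulf1.
move=> i; exists 1; congr (_ @` _)%classic.
by apply/funext => x; rewrite conjg1.
Qed.

Lemma pure_symV : invg_closed pure_sym.
Proof.
move=> _ /asboolP[a <- aP]; apply/asboolP.
exists a^-1; first by rewrite homV.
move=> i; have [g ag] := aP i; exists (a^-1 g)^-1.
apply/seteqP; split=> _ [x xG <-].
  have : ((fun x => x ^ g) @` [set` Gs i])%classic (x ^ g) by exists x.
  rewrite -ag => -[y yG ay]; exists y => //.
  apply: (can_inj (autK a)).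
  by rewrite autJ aut_funV ay !autVK conjgK.
have : (a @` [set` Gs i])%classic (a x) by exists x.
rewrite ag => -[y yG ay]; exists y => //.
apply: (can_inj (autK a)).
by rewrite autVK autJ aut_funV -ay autVK conjgK.
Qed.

HB.instance Definition _ := isMulClosed.Build (Out G) pure_sym pure_symM.
HB.instance Definition _ := isMul1Closed.Build (Out G) pure_sym pure_sym1.
HB.instance Definition _ := isInvClosed.Build (Out G) pure_sym pure_symV.

Definition OutS := subgp pure_sym.

HB.instance Definition _ := Group.on OutS.

Lemma out_class_pure a : preserves_conj_classes a -> out_class a \in pure_sym.
Proof. by move=> aP; apply/asboolP; exists a. Qed.

Definition outs (a : aut G) (aP : preserves_conj_classes a) : OutS :=
  Subgp (out_class_pure aP).

End PureSymmetric.

Section Image.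
Variables (G H : groupType) (f : {hom G -> H}).

Definition himg : {pred H} := fun y => `[< exists x, y = f x >].

Lemma himgM : mulg_closed himg.
Proof.
move=> _ _ /asboolP[x ->] /asboolP[y ->]; apply/asboolP.
by exists (x * y); rewrite gmulfM.
Qed.
Lemma himg1 : 1 \in himg.
Proof. by apply/asboolP; exists 1; rewrite gmulf1. Qed.
Lemma himgV : invg_closed himg.
Proof.
by move=> _ /asboolP[x ->]; apply/asboolP; exists x^-1; rewrite homV.
Qed.

HB.instance Definition _ := isMulClosed.Build H himg himgM.
HB.instance Definition _ := isMul1Closed.Build H himg himg1.
HB.instance Definition _ := isInvClosed.Build H himg himgV.

Lemma mem_himg x : f x \in himg.
Proof. by apply/asboolP; exists x. Qed.

Definition himg_in (x : G) : subgp himg := Subgp (mem_himg x).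

End Image.

Definition dprodg (I : Type) (K : I -> groupType) := forall i, K i.

Section DirectProduct.
Variables (I : Type) (K : I -> groupType).

HB.instance Definition _ := gen_eqMixin (dprodg K).
HB.instance Definition _ := gen_choiceMixin (dprodg K).

Definition dprodg_one : dprodg K := fun=> 1.
Definition dprodg_inv (u : dprodg K) : dprodg K := fun i => (u i)^-1.
Definition dprodg_mul (u v : dprodg K) : dprodg K := fun i => u i * v i.

Lemma dprodg_mulA : associative dprodg_mul.
Proof. by move=> u v w; apply: functional_extensionality_dep => i;
  apply: mulgA. Qed.
Lemma dprodg_mul1 : left_id dprodg_one dprodg_mul.
Proof. by move=> u; apply: functional_extensionality_dep => i;
  apply: mul1g. Qed.
Lemma dprodg_1mul : right_id dprodg_one dprodg_mul.
Proof. by move=> u; apply: functional_extensionality_dep => i;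
  apply: mulg1. Qed.
Lemma dprodg_mulV : left_inverse dprodg_one dprodg_inv dprodg_mul.
Proof. by move=> u; apply: functional_extensionality_dep => i;
  apply: mulVg. Qed.
Lemma dprodg_Vmul : right_inverse dprodg_one dprodg_inv dprodg_mul.
Proof. by move=> u; apply: functional_extensionality_dep => i;
  apply: mulgV. Qed.

HB.instance Definition _ := isGroup.Build (dprodg K)
  dprodg_mulA dprodg_mul1 dprodg_1mul dprodg_mulV dprodg_Vmul.

End DirectProduct.

(* The subgroups [Gs i] of [G] are free factors of which [G] is the internal  *)
(* free product.                                                              *)
Definition free_splitting (I : choiceType) (G : groupType)
    (Gs : I -> groupClosed G) : Prop :=
  bijective (fprodg_lift (fun i => incl (Gs i))).

Section Splitting.
Variables (I : choiceType) (G : groupType) (Gs : I -> groupClosed G).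
Hypothesis fs : free_splitting Gs.

Lemma splitting_inv_ex :
  {s : G -> fprodg (fun i => subgp (Gs i) : groupType) |
    cancel (fprodg_lift (fun i => incl (Gs i))) s
    /\ cancel s (fprodg_lift (fun i => incl (Gs i)))}.
Proof. by apply: cid; case: fs => s sK Ks; exists s. Qed.

(* The homomorphism with prescribed restrictions to the free factors.         *)
Definition ext (H : groupType) (f : forall i, {hom subgp (Gs i) -> H})
    (x : G) : H :=
  fprodg_lift f (sval splitting_inv_ex x).

Lemma ext_morph (H : groupType) f : monoid_morphism (@ext H f).
Proof.
rewrite /ext; case: splitting_inv_ex => s /= [sK Ks].
split=> [|x y].
  have e1 : fprodg_lift (fun i => incl (Gs i)) 1 = 1 by apply: gmulf1.
  by rewrite -[X in s X]e1 sK gmulf1.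
by rewrite -{1}[x]Ks -{1}[y]Ks -gmulfM sK gmulfM.
Qed.

HB.instance Definition _ (H : groupType) f :=
  isUMagmaMorphism.Build G H (@ext H f) (@ext_morph H f).

Lemma extE (H : groupType) (f : forall i, {hom subgp (Gs i) -> H})
    i (x : subgp (Gs i)) :
  ext f (val x) = f i x.
Proof.
rewrite /ext; case: splitting_inv_ex => s /= [sK Ks].
have -> : val x = fprodg_lift (fun i => incl (Gs i)) (fprodg_in x).
  by rewrite fprodg_lift_in.
by rewrite sK fprodg_lift_in.
Qed.

Lemma splitting_hom_eq (H : groupType) (f g : {hom G -> H}) :
  (forall i (x : subgp (Gs i)), f (val x) = g (val x)) -> f =1 g.
Proof.
move=> fg x; case: splitting_inv_ex => s [_ Ks]; rewrite -[x]Ks.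
rewrite -[LHS]/((f \o fprodg_lift (fun i => incl (Gs i))) (s x)).
rewrite -[RHS]/((g \o fprodg_lift (fun i => incl (Gs i))) (s x)).
apply: fprodg_hom_eq => i y /=.
by rewrite fprodg_lift_in; apply: fg.
Qed.

(* Since [x ^ g = g^-1 x g], [inner g^-1] maps [x] to [g x g^-1].              *)
Definition conj_factor (j : I) (g : G) (k : I) : {hom subgp (Gs k) -> G} :=
  if k == j then (inner g^-1 \o incl (Gs k) : {hom subgp (Gs k) -> G})
  else incl (Gs k).

Definition pconj_fun (i j : I) (g : subgp (Gs i)) : {hom G -> G} :=
  ext (conj_factor j (val g)).

Lemma pconj_funE i j (g : subgp (Gs i)) k (x : subgp (Gs k)) :
  pconj_fun j g (val x) = if k == j then val x ^ (val g)^-1 else val x.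
Proof. by rewrite [LHS]extE /conj_factor; case: eqP. Qed.

Lemma pconj_fun_self i j (g : subgp (Gs i)) h :
  h * g = g * h -> pconj_fun j h (val g) = val g.
Proof.
move=> hg; rewrite pconj_funE; case: eqP => // _.
by rewrite /conjg invgK mulgA -subgpM hg subgpM mulgK.
Qed.

Lemma pconj_funK i j (g : subgp (Gs i)) :
  cancel (pconj_fun j g) (pconj_fun j g^-1).
Proof.
apply: (@splitting_hom_eq G (pconj_fun j g^-1 \o pconj_fun j g) idfun).
move=> k x; rewrite -[LHS]/(pconj_fun j g^-1 (pconj_fun j g (val x))).
rewrite pconj_funE; case: ifP => kj; last by rewrite pconj_funE kj.
rewrite /conjg !gmulfM !homV !pconj_fun_self ?mulVg ?mulgV //.
by rewrite pconj_funE kj subgpV !invgK /conjg !mulgA mulgV mul1g mulgK.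
Qed.

Definition pconj (i j : I) (g : subgp (Gs i)) : aut G :=
  @Aut G (pconj_fun j g) (pconj_fun j g^-1)
    (@gmulfM _ _ (pconj_fun j g))
    (pconj_funK j g)
    (eq_ind _ (fun h => cancel (pconj_fun j g^-1) (pconj_fun j h))
       (pconj_funK j g^-1) _ (invgK g)).

Lemma pconjE i j (g : subgp (Gs i)) k (x : subgp (Gs k)) :
  pconj j g (val x) = if k == j then val x ^ (val g)^-1 else val x.
Proof. exact: pconj_funE. Qed.


Lemma pconj_pure i j (g : subgp (Gs i)) : preserves_conj_classes Gs (pconj j g).
Proof.
move=> k; exists (if k == j then (val g)^-1 else 1).
apply: eq_imagel => x xG; rewrite (pconjE j g (Subgp xG)) /=.
by case: eqP; rewrite ?conjg1.
Qed.

Lemma outsM a b aP bP abP :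
  @outs _ _ Gs (a * b) abP = outs (aP : preserves_conj_classes Gs a) *
                             outs (bP : preserves_conj_classes Gs b).
Proof. by apply: val_inj; rewrite subgpM -[LHS]/(out_class (a * b)) gmulfM. Qed.

Lemma outs_eq a b aP bP : a = b -> @outs _ _ Gs a aP = @outs _ _ Gs b bP.
Proof. by move=> ab; apply: val_inj; rewrite /= ab. Qed.

Lemma aut_splitting_eq (a b : aut G) :
  (forall i (x : subgp (Gs i)), a (val x) = b (val x)) -> a = b.
Proof. by move=> ab; apply: aut_eq; apply: splitting_hom_eq. Qed.

Lemma pconjM i j (g h : subgp (Gs i)) :
  i != j -> pconj j (g * h) = pconj j g * pconj j h.
Proof.
move=> ij; apply: aut_splitting_eq => k x.
rewrite autME !pconjE; case: ifP => kj; last by rewrite pconjE kj.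
rewrite autJ aut_funV !pconjE kj (negPf ij).
by rewrite subgpM invgM conjgM.
Qed.

(* [ij] is not used in the definition, but [f_ ij] is a morphism only thanks  *)
(* to it.                                                                     *)
Definition f_ (i j : I) (ij : i != j) (g : subgp (Gs i)) : OutS Gs :=
  outs (pconj_pure j g).

Lemma f_F i j (ij : i != j) : {morph f_ ij : g h / g / h}.
Proof.
have fM : {morph f_ ij : g h / g * h}.
  move=> g h; have := pconj_pure j (g * h); rewrite pconjM// => P.
  by rewrite -(outsM _ _ P); apply: outs_eq; apply: pconjM.
by move=> g h; apply: (mulIg (f_ ij h)); rewrite -fM !mulgVK.
Qed.

HB.instance Definition _ i j (ij : i != j) :=
  isGroupMorphism.Build (subgp (Gs i)) (OutS Gs) (f_ ij) (@f_F i j ij).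

(* The subgroup [G_{i_j}] of [OutS Gs].                                        *)
Definition Gsub (i j : I) (ij : i != j) : groupType := subgp (himg (f_ ij)).

Definition Phi : groupType := dprodg (fun k => aut (subgp (Gs k))).

Definition factor_fun (phi : Phi) : {hom G -> G} :=
  ext (fun k => (incl (Gs k) \o phi k : {hom subgp (Gs k) -> G})).

Lemma factor_funE (phi : Phi) k (x : subgp (Gs k)) :
  factor_fun phi (val x) = val (phi k x).
Proof. exact: extE. Qed.

Lemma factor_funK (phi psi : Phi) : (forall k, cancel (phi k) (psi k)) ->
  cancel (factor_fun phi) (factor_fun psi).
Proof.
move=> pK; apply: (@splitting_hom_eq G (factor_fun psi \o factor_fun phi)
  idfun).
move=> k x; rewrite -[LHS]/(factor_fun psi (factor_fun phi (val x))).
by rewrite !factor_funE pK.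
Qed.

Definition factor_aut (phi : Phi) : aut G :=
  @Aut G (factor_fun phi) (factor_fun phi^-1) (@gmulfM _ _ (factor_fun phi))
    (factor_funK (fun k => @autK _ (phi k)))
    (factor_funK (fun k => @autVK _ (phi k))).

Lemma factor_autE phi k (x : subgp (Gs k)) :
  factor_aut phi (val x) = val (phi k x).
Proof. exact: factor_funE. Qed.

Lemma factor_autM phi psi :
  factor_aut (phi * psi) = factor_aut phi * factor_aut psi.
Proof. by apply: aut_splitting_eq => k x; rewrite autME !factor_autE. Qed.

Lemma factor_aut_pure phi : preserves_conj_classes Gs (factor_aut phi).
Proof.
move=> k; exists 1; apply/seteqP; split=> _ [x xG <-].
  exists (val (phi k (Subgp xG))); first exact: valP.
  by rewrite conjg1 -factor_autE.
exists (val ((phi k)^-1 (Subgp xG))); first exact: valP.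
by rewrite factor_autE autVK conjg1.
Qed.

Definition Phi_out (phi : Phi) : OutS Gs := outs (factor_aut_pure phi).

Lemma Phi_outF : {morph Phi_out : phi psi / phi / psi}.
Proof.
have PM : {morph Phi_out : phi psi / phi * psi}.
  move=> phi psi; have := factor_aut_pure (phi * psi); rewrite factor_autM => P.
  by rewrite -(outsM _ _ P); apply: outs_eq; apply: factor_autM.
by move=> phi psi; apply: (mulIg (Phi_out psi)); rewrite -PM !mulgVK.
Qed.

HB.instance Definition _ := isGroupMorphism.Build Phi (OutS Gs)
  Phi_out Phi_outF.

(* [Ad g] is [x |-> g^-1 x g] on the factor containing [g], and trivial on    *)
(* the other ones.                                                            *)
Definition Ad (i : I) (g : subgp (Gs i)) : Phi :=
  dfwith (1 : Phi) (inner g : aut (subgp (Gs i))).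

(* The pair [(i, j)] indexes [G_{i_j}], and [None] indexes [Phi].             *)
Definition gen_index : choiceType := option {p : I * I | p.1 != p.2}.

Definition gen_group (a : gen_index) : groupType :=
  if a is Some (exist _ ij) then Gsub ij else Phi.

Definition gen_hom (a : gen_index) : {hom gen_group a -> OutS Gs} :=
  match a with
  | Some (exist _ ij) => incl (himg (f_ ij))
  | None => Phi_out
  end.

Definition gen_f (i j : I) (ij : i != j) (g : subgp (Gs i)) :
    fprodg gen_group :=
  @fprodg_in _ gen_group (Some (exist _ (i, j) ij)) (himg_in (f_ ij) g).

Definition gen_Phi (phi : Phi) : fprodg gen_group :=
  @fprodg_in _ gen_group None phi.

End Splitting.

Section Relations.
Variables (G : groupType) (Gs : 'I_4 -> groupClosed G).
Hypothesis fs : free_splitting Gs.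

Local Notation f := (gen_f fs).
Local Notation phi_ := (gen_Phi fs).

(* The proofs [ij : i != j] only serve to name the group [G_{i_j}]: they are  *)
(* unique, and exist since [i, j, k, l] are [0, 1, 2, 3] in some order.       *)
Inductive relations : fprodg (gen_group fs) -> Prop :=
| rel1 i j k l (ij : i != j) (ik : i != k) (g h : subgp (Gs i)) :
    [set i; j; k; l]%SET = [set: 'I_4]%SET ->
    relations [~ f ij g, f ik h]
| rel2 i j k l (ij : i != j) (kl : k != l) (g : subgp (Gs i))
    (h : subgp (Gs k)) :
    [set i; j; k; l]%SET = [set: 'I_4]%SET ->
    relations [~ f ij g, f kl h]
| rel3 i j k l (ij : i != j) (ik : i != k) (il : i != l) (g : subgp (Gs i)) :
    [set i; j; k; l]%SET = [set: 'I_4]%SET ->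
    relations (f ij g * f ik g * f il g / phi_ (Ad g))
| rel4 i j k l (ij : i != j) (g : subgp (Gs i)) (phi : Phi Gs) :
    [set i; j; k; l]%SET = [set: 'I_4]%SET ->
    relations ((phi_ phi)^-1 * f ij g * phi_ phi / f ij (phi i g)).

End Relations.

(* Main.v *)
(** The idea is peak reduction in the Bass-Serre tree of the splitting. Up to
    [Phi] and conjugation, an outer automorphism is a basis of conjugates
    [Gs i ^ t i], that is, four vertices of the tree; [f_{i_j}(g)] moves the
    [j]-th vertex by an element of the stabilizer of the [i]-th one. Let the
    complexity of a basis be the sum of the distances between its vertices.
    Each orbit under the moves that fix a given vertex contains, up to [Phi]
    and conjugation, exactly one basis in which the three other vertices all
    lie in the same direction from it; this basis (the gate) is the one of
    least complexity. If every vertex is already such a leaf, then, because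
    the conjugates generate [G], the basis is conjugate to the standard one;
    hence the groups generate. For the relations, all descents from a basis
    through gates give the same element of the presented group: when both the
    vertices [i] and [k] allow a descent, a third vertex [j] that lies in
    another direction than [k] from [i] must lie in the direction of [i] from
    [k]. So, as there are only four vertices, the
    descents at [i] and at [k] move different vertices [j] and [l], and relation
    2 makes them commute. *)
Require Import Defs.
From HB Require Import structures.
From mathcomp Require Import boolp classical_sets.
From mathcomp Require Import all_boot.
From mathcomp Require Import generic_quotient.

Set Implicit Arguments.
Unset Strict Implicit.
Unset Printing Implicit Defensive.

Local Open Scope group_scope.
Local Open Scope quotient_scope.

(** * Normal forms in an internal free product *)

Section NormalForm.
Variables (I : choiceType) (G : groupType) (Gs : I -> groupClosed G).
Implicit Types (i j : I) (x y g h : G) (w : seq (I * G)).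

Definition reduced w :=
  all (fun a => (a.2 \in Gs a.1) && (a.2 != 1)) w
  && sorted (fun a b => a.1 != b.1) w.

Definition whead i w := if w is (j, x) :: _ then if j == i then x else 1 else 1.
Definition wtail i w :=
  if w is (j, x) :: w' then if j == i then w' else w else [::].
Definition wcons i x w := if x == 1 then w else (i, x) :: w.
(** This is van der Waerden's trick: left multiplication by an element of one factor, written
    directly on reduced words. *)
Definition wact i x w := wcons i (x * whead i w) (wtail i w).
Definition wprod w := \prod_(a <- w) a.2.

Lemma reduced_tail a w : reduced (a :: w) -> reduced w.
Proof.
by rewrite /reduced /= => /andP[/andP[_ ->] /path_sorted ->].
Qed.

(** Letters of a reduced word are nontrivial, so for such [w] the condition [whead i w == 1] says
    that [w] does not begin in factor [i]. *)
Lemma reduced_cons i x w :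
  reduced ((i, x) :: w) = [&& x \in Gs i, x != 1, whead i w == 1 & reduced w].
Proof.
rewrite /reduced /=; case: w => [|[j y] w] /=; first by rewrite eqxx !andbT.
rewrite [i == j]eq_sym; case: (eqVneq j i) => [->|_] /=.
  by case: (y == 1); rewrite /= ?andbF.
by rewrite eqxx -!andbA.
Qed.

Lemma whead_in i w : reduced w -> whead i w \in Gs i.
Proof.
case: w => [|[j x] w] /=; first by rewrite gpred1.
rewrite reduced_cons => /andP[xG _]; case: eqP => [<-//|_].
exact: gpred1.
Qed.

Lemma wconsK i w : reduced w -> wcons i (whead i w) (wtail i w) = w.
Proof.
case: w => [|[j x] w] /=; rewrite /wcons ?eqxx // reduced_cons.
case/and4P=> _ x1 _ _; case: (eqVneq j i) => [<-|_]; last by rewrite eqxx.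
by rewrite (negPf x1).
Qed.

Lemma wtail_reduced i w : reduced w -> reduced (wtail i w).
Proof.
by case: w => [|[j x] w] //= wr; case: ifP => // _; apply: reduced_tail wr.
Qed.

Lemma whead_tail i w : reduced w -> whead i (wtail i w) = 1.
Proof.
case: w => [|[j x] w] //=; rewrite reduced_cons.
case/and4P=> _ _ /eqP hw _; case: (eqVneq j i) => [<-//|ji] /=.
by rewrite (negPf ji).
Qed.

Lemma whead_cons i x w : whead i w = 1 -> whead i (wcons i x w) = x.
Proof. by rewrite /wcons; case: eqP => [->|_ _] //=; rewrite eqxx. Qed.

Lemma wtail_id i w : reduced w -> whead i w = 1 -> wtail i w = w.
Proof.
case: w => [|[j x] w] //=; rewrite reduced_cons.
by case: (eqVneq j i) => // _ /and4P[_ /eqP].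
Qed.

Lemma wtail_cons i x w :
  reduced w -> whead i w = 1 -> wtail i (wcons i x w) = w.
Proof.
by rewrite /wcons => wr wh; case: eqP => _ /=; rewrite ?eqxx ?wtail_id.
Qed.

Lemma wcons_reduced i x w :
  x \in Gs i -> reduced w -> whead i w = 1 -> reduced (wcons i x w).
Proof.
rewrite /wcons; case: eqP => // /eqP x1 xG wr /eqP wh.
by rewrite reduced_cons xG x1 wh wr.
Qed.

Lemma wact_reduced i x w : x \in Gs i -> reduced w -> reduced (wact i x w).
Proof.
move=> xG wr; apply: wcons_reduced; rewrite ?whead_tail ?wtail_reduced //.
by rewrite gpredM ?whead_in.
Qed.

Lemma wactM i x y w : reduced w -> wact i x (wact i y w) = wact i (x * y) w.
Proof.
move=> wr; rewrite /wact whead_cons ?whead_tail // wtail_cons ?mulgA //.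
- exact: wtail_reduced.
- exact: whead_tail.
Qed.

Lemma wact1 i w : reduced w -> wact i 1 w = w.
Proof. by move=> wr; rewrite /wact mul1g wconsK. Qed.

Lemma wprod_cons i x w : wprod ((i, x) :: w) = x * wprod w.
Proof. by rewrite /wprod big_cons. Qed.

Lemma wprod_wact i x w : reduced w -> wprod (wact i x w) = x * wprod w.
Proof.
have wprod_wcons y v : wprod (wcons i y v) = y * wprod v.
  by rewrite /wcons; case: eqP => [->|_]; rewrite ?mul1g ?wprod_cons.
move=> wr; rewrite /wact wprod_wcons -[w in RHS](wconsK i wr).
by rewrite wprod_wcons mulgA.
Qed.

Definition winv w := rev [seq (a.1, a.2^-1) | a <- w].

Lemma winv_reduced w : reduced w -> reduced (winv w).
Proof.
rewrite /reduced /winv => /andP[/allP wG ws]; apply/andP; split.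
  rewrite all_rev all_map; apply/allP => a /wG /andP[aG a1] /=.
  by rewrite gpredV aG invg_eq1.
rewrite rev_sorted sorted_map; apply: sub_sorted ws => a b /=.
by rewrite eq_sym.
Qed.

Lemma wprod_winv w : wprod (winv w) = (wprod w)^-1.
Proof.
rewrite /winv /wprod; elim: w => [|[i x] w IHw] /=.
  by rewrite !big_nil invg1.
by rewrite rev_cons -cats1 big_cat /= big_seq1 IHw big_cons invgM.
Qed.

(** The last letter of [w1] is the inverse of the first one of [winv w1], so [whead] controls both
    junctions. *)
Lemma reduced_mid w1 i x w2 : reduced w1 -> reduced w2 ->
  x \in Gs i -> x != 1 -> whead i (winv w1) = 1 -> whead i w2 = 1 ->
  reduced (w1 ++ (i, x) :: w2).
Proof.
move=> r1 r2 xG x1 h1 h2.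
have : reduced ((i, x) :: w2) by rewrite reduced_cons xG x1 h2 eqxx.
have : reduced ((i, x^-1) :: winv w1).
  by rewrite reduced_cons gpredV xG invg_eq1 x1 h1 eqxx winv_reduced.
move=> /winv_reduced; rewrite {1}/winv /= rev_cons.
have -> : rev [seq (a.1, a.2^-1) | a <- winv w1] = w1.
  rewrite /winv map_rev revK -map_comp -[RHS]map_id; apply: eq_map.
  by case=> j y /=; rewrite invgK.
rewrite invgK /reduced all_cat -cats1 !all_cat => /andP[/andP[-> _] s1].
by move=> /andP[-> s2]; rewrite sorted_cat_cons -cats1 s1.
Qed.

(** * Normal forms, lengths and first syllables of group elements *)

Hypothesis fs : free_splitting Gs.

Lemma splitting_ind (Q : G -> Prop) : Q 1 ->
  (forall i x g, x \in Gs i -> Q g -> Q (x * g)) -> forall g, Q g.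
Proof.
move=> Q1 QM g; case: (splitting_inv_ex fs) => s [_ Ks]; rewrite -[g]Ks.
rewrite -[s g]reprK fprodg_liftE.
elim: (repr (s g)) => [|[i x] u IHu]; first by rewrite /fword_eval big_nil.
rewrite /fword_eval big_cons; apply: (QM i); last exact: IHu.
exact: valP.
Qed.

Definition fword_act (u : fword (fun i => subgp (Gs i) : groupType)) w :=
  foldr (fun p : {i : I & subgp (Gs i)} => wact (tag p) (val (tagged p))) w u.

Lemma fword_act_reduced u w : reduced w -> reduced (fword_act u w).
Proof.
move=> wr; elim: u => //= -[i x] u IHu.
by apply: wact_reduced => //; apply: valP.
Qed.

(** The action respects the merging of adjacent letters and the deletion of trivial ones, hence
    factors through the free product; this makes [nf] independent of the chosen word. *)
Lemma fword_act_eq u v w : reduced w -> fword_eq u v ->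
  fword_act u w = fword_act v w.
Proof.
move=> wr; elim=> {u v} [u v i x y|u v i|//|//|u v t _ -> _ -> //].
  rewrite /fword_act !foldr_cat /=; congr foldr.
  by rewrite wactM ?subgpM //; apply: fword_act_reduced.
rewrite /fword_act !foldr_cat /=; congr foldr.
by rewrite wact1 //; apply: fword_act_reduced.
Qed.

Definition nf g : seq (I * G) :=
  fword_act (repr (sval (splitting_inv_ex fs) g)) [::].

Lemma nf_reduced g : reduced (nf g).
Proof. exact: fword_act_reduced. Qed.

Lemma nf1 : nf 1 = [::].
Proof.
rewrite /nf; case: splitting_inv_ex => s /= [sK Ks].
have {1}<- : fprodg_lift (fun i => incl (Gs i)) 1 = 1 by apply: gmulf1.
rewrite sK; rewrite (@fword_act_eq _ [::]) //.
by apply/fprodgP; rewrite reprK.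
Qed.

Lemma nfM i x g : x \in Gs i -> nf (x * g) = wact i x (nf g).
Proof.
move=> xG; rewrite /nf; case: splitting_inv_ex => s /= [sK Ks].
pose K (j : I) : groupType := subgp (Gs j).
have -> : s (x * g) = @fprodg_in _ K i (Subgp xG) * s g.
  by apply: (can_inj sK); rewrite gmulfM /= fprodg_lift_in !Ks.
rewrite -[RHS]/(fword_act (letter (Subgp xG : K i) :: repr (s g)) [::]).
apply: fword_act_eq => //; apply/fprodgP; rewrite reprK.
by rewrite -[s g in LHS]reprK [LHS]fprodg_mulE.
Qed.

Lemma nfK g : wprod (nf g) = g.
Proof.
elim/splitting_ind: g => [|i x g xG IHg]; first by rewrite nf1 /wprod big_nil.
by rewrite (nfM _ xG) wprod_wact ?nf_reduced // IHg.
Qed.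

(** Uniqueness of reduced expressions: when the letters of [w] act in turn on the empty word,
    nothing cancels and [w] is rebuilt. *)
Lemma wprodK w : reduced w -> nf (wprod w) = w.
Proof.
elim: w => [|[i x] w IHw]; first by rewrite /wprod big_nil nf1.
move=> xwr; have wr := reduced_tail xwr; have nw := IHw wr.
move: xwr; rewrite reduced_cons => /and4P[xG x1 /eqP wh _].
rewrite wprod_cons (nfM _ xG) nw /wact wh mulg1 wtail_id // /wcons.
by rewrite (negPf x1).
Qed.

Lemma nfV g : nf g^-1 = winv (nf g).
Proof.
by rewrite -{1}[g]nfK -wprod_winv wprodK // winv_reduced ?nf_reduced.
Qed.

Definition len g := size (nf g).

Lemma lenV g : len g^-1 = len g.
Proof. by rewrite /len nfV /winv size_rev size_map. Qed.

Lemma len_syl i x g : x \in Gs i -> len (x * g) <= len g + (x != 1).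
Proof.
move=> xG; rewrite /len (nfM _ xG) /wact /wcons.
have : size (wtail i (nf g)) <= size (nf g).
  by case: (nf g) => //= -[j y] w /=; case: ifP.
case: eqP => [_|] /=; first by move/leq_trans; apply; apply: leq_addr.
move: (nf_reduced g); case: (nf g) => [|[j y] w] /=.
  by rewrite mulg1 => _ /eqP ->.
case: ifP => _ _; first by rewrite leq_addr.
by rewrite mulg1 => /eqP ->; rewrite addn1.
Qed.

Lemma len1 : len 1 = 0.
Proof. by rewrite /len nf1. Qed.

Lemma lenM g h : len (g * h) <= len g + len h.
Proof.
rewrite -{1}[g]nfK /len -/(len _) -/(len h).
elim: (nf g) (nf_reduced g) => [|[i x] w IHw].
  by rewrite /wprod big_nil mul1g.
rewrite reduced_cons => /and4P[xG _ _ wr]; rewrite wprod_cons -mulgA /=.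
apply: leq_trans (len_syl _ xG) _; rewrite addSn -addn1 leq_add ?IHw //.
by case: eqP.
Qed.

Lemma len0 g : len g = 0 -> g = 1.
Proof. by move=> /size0nil e; rewrite -[g]nfK e /wprod big_nil. Qed.

(** Dividing [g] on the left by [syl i g] gives the shortest element of the coset [Gs i * g]. *)
Definition syl i g := whead i (nf g).

Lemma syl_in i g : syl i g \in Gs i.
Proof. by rewrite /syl whead_in ?nf_reduced. Qed.

Lemma syl1 i : syl i 1 = 1.
Proof. by rewrite /syl nf1. Qed.

Lemma sylM i x g : x \in Gs i -> syl i (x * g) = x * syl i g.
Proof.
by move=> xG; rewrite /syl (nfM _ xG) whead_cons // whead_tail ?nf_reduced.
Qed.

Lemma sylK i g : syl i ((syl i g)^-1 * g) = 1.
Proof. by rewrite sylM ?mulVg // gpredV syl_in. Qed.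

(** The condition on [g^-1] says that [g] does not end in factor [i], so [x] merges with neither
    neighbour. *)
Lemma nf_mid g i x h : x \in Gs i -> x != 1 -> syl i g^-1 = 1 ->
  syl i h = 1 -> nf (g * x * h) = nf g ++ (i, x) :: nf h.
Proof.
rewrite /syl nfV => xG x1 gh hh.
have r := reduced_mid (nf_reduced g) (nf_reduced h) xG x1 gh hh.
rewrite -[RHS]wprodK // /wprod big_cat big_cons /= -!/(wprod _) !nfK.
by rewrite mulgA.
Qed.

Lemma len_mid g i x h : x \in Gs i -> x != 1 -> syl i g^-1 = 1 ->
  syl i h = 1 -> len (g * x * h) = (len g + len h).+1.
Proof.
by move=> xG x1 gh hh; rewrite /len (nf_mid xG) // size_cat addnS.
Qed.

Lemma syl_mid k g i x h : x \in Gs i -> x != 1 -> syl i g^-1 = 1 ->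
  syl i h = 1 -> i != k -> syl k (g * x * h) = syl k g.
Proof.
move=> xG x1 gh hh ik; rewrite /syl (nf_mid xG) //.
by case: (nf g) => [|[j y] w] //=; rewrite (negPf ik).
Qed.

Lemma nf_in i x : x \in Gs i -> x != 1 -> nf x = [:: (i, x)].
Proof.
by move=> xG x1; rewrite -[x in nf x]mulg1 -[x in nf (x * 1)]mul1g
  (nf_mid xG) ?nf1 ?invg1 ?syl1.
Qed.

(** Both [g] and [g * x] are a common [c], not ending in factor [i], times an element of [Gs i];
    appending such a letter to [c] does not affect an initial [k]-syllable. *)
Lemma syl_rM k i x g : x \in Gs i -> i != k -> syl k (g * x) = syl k g.
Proof.
move=> xG ik; set y := (syl i g^-1)^-1.
have yG : y \in Gs i by rewrite gpredV syl_in.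
pose c := g * y^-1; have ec : syl i c^-1 = 1 by rewrite /c invgM invgK sylK.
have cE z : z \in Gs i -> syl k (c * z) = syl k c.
  move=> zG; have [->|z1] := eqVneq z 1; first by rewrite mulg1.
  by rewrite -[c * z]mulg1 (syl_mid zG) ?syl1.
have -> : g = c * y by rewrite /c mulgVK.
by rewrite -mulgA !cE // gpredM.
Qed.

(** Once the first [i]-syllable of [n] is absorbed into [x], the conjugate has length one plus twice
    that of the rest [r]; as this length is one, [r] is trivial. *)
Lemma self_normalizing i x n : x \in Gs i -> x != 1 -> x ^ n \in Gs i ->
  n \in Gs i.
Proof.
move=> xG x1; pose r := (syl i n)^-1 * n.
have ri : syl i r = 1 by apply: sylK.
have {2}-> : n = syl i n * r by rewrite /r mulVKg.
have -> : n = syl i n * r by rewrite /r mulVKg.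
rewrite conjgM; set y := x ^ syl i n => yr.
have yG : y \in Gs i by rewrite /y /conjg !gpredM ?gpredV ?syl_in.
have y1 : y != 1 by rewrite /y conjg_eq1.
have yr1 : y ^ r != 1 by rewrite conjg_eq1.
have : len (y ^ r) = 1%N by rewrite /len (nf_in yr).
rewrite /conjg mulgA (len_mid yG) ?invgK // lenV => -[] /eqP.
rewrite addn_eq0 => /andP[/eqP /len0 -> _].
by rewrite mulg1 syl_in.
Qed.

End NormalForm.

(** * Tuples of conjugating elements and their complexity *)

Section Tuples.
Variables (I : finType) (G : groupType) (Gs : I -> groupClosed G).
Hypothesis fs : free_splitting Gs.
Implicit Types (i j k l : I) (g : G) (t : I -> G).

Local Notation syl := (syl fs).
Local Notation len := (len fs).

Lemma val_in i (x : subgp (Gs i)) : val x \in Gs i.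
Proof. exact: valP. Qed.

(** For [i != j] this is a shortest representative of the double coset [Gs i * g * Gs j]; see
    [core_mul] and [len_core_le]. *)
Definition core i j g := (syl i g)^-1 * g * syl j g^-1.

Lemma coreV i j g : core j i g^-1 = (core i j g)^-1.
Proof. by rewrite /core !invgM !invgK mulgA. Qed.

Lemma syl_core i j g : i != j -> syl i (core i j g) = 1.
Proof.
by move=> ij; rewrite /core (syl_rM _ _ (syl_in fs j _)) ?sylK // eq_sym.
Qed.

Lemma syl_coreV i j g : i != j -> syl j (core i j g)^-1 = 1.
Proof. by move=> ij; rewrite -coreV syl_core // eq_sym. Qed.

Lemma core_mul i j a g b : i != j -> a \in Gs i -> b \in Gs j ->
  core i j (a * g * b) = core i j g.
Proof.
move=> ij aG bG; rewrite /core !invgM (syl_rM _ _ bG) 1?eq_sym //.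
rewrite sylM // sylM ?gpredV // (syl_rM _ _ (_ : a^-1 \in Gs i)) ?gpredV //.
by rewrite invgM !mulgA mulgK mulgVK.
Qed.

Lemma len_mul_le i a g : a \in Gs i -> syl i g = 1 -> len g <= len (a * g).
Proof.
move=> aG gi; have [->|a1] := eqVneq a 1; first by rewrite mul1g.
by rewrite -[a]mul1g (len_mid aG) ?invg1 ?syl1 // len1 add0n.
Qed.

Lemma len_core_le i j a g b : i != j -> a \in Gs i -> b \in Gs j ->
  len (core i j g) <= len (a * g * b).
Proof.
move=> ij aG bG.
have -> : a * g * b = (a * syl i g) * (core i j g * ((syl j g^-1)^-1 * b)).
  by rewrite /core !mulgA !mulgK.
have bG' : (syl j g^-1)^-1 * b \in Gs j by rewrite gpredM // gpredV syl_in.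
apply: leq_trans (len_mul_le (_ : a * _ \in Gs i) _); last 2 first.
- by rewrite gpredM ?syl_in.
- by rewrite (syl_rM _ _ bG') 1?eq_sym // syl_core.
have := @len_mul_le j ((syl j g^-1)^-1 * b)^-1 (core i j g)^-1.
by rewrite -invgM !lenV; apply; rewrite ?gpredV // syl_coreV.
Qed.

(* In the Bass-Serre tree whose vertices are the elements of [G] and the
   cosets [Gs i * g], a tuple [t] stands for the vertices [Gs i * t i], with
   stabilizers [Gs i ^ t i]. The element [(fst_syl i j t)^-1 * t i] is the
   neighbour of the [i]-th vertex that points towards the [j]-th one, and
   [dist i j t] is half their distance, minus one. *)
Definition fst_syl i j t : subgp (Gs i) := Subgp (syl_in fs i (t i / t j)).
Definition dist i j t := len (core i j (t i / t j)).

Lemma distC i j t : dist i j t = dist j i t.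
Proof. by rewrite /dist -lenV -coreV invgF. Qed.

(** The middle factor is the turn made at the [i]-th vertex on the way between the [j]-th and the
    [k]-th one. *)
Lemma fst_syl_split i j k t :
  t j / t k = (t j / t i * val (fst_syl i j t))
              * ((val (fst_syl i j t))^-1 * val (fst_syl i k t))
              * ((val (fst_syl i k t))^-1 * (t i / t k)).
Proof. by rewrite !mulgA !mulgK mulgVK. Qed.

Lemma fst_syl_end i j t : syl i (t j / t i * val (fst_syl i j t))^-1 = 1.
Proof. by rewrite invgM invgF /= sylK. Qed.

Lemma fst_syl_neq i j k t : (fst_syl i j t != fst_syl i k t) =
  ((val (fst_syl i j t))^-1 * val (fst_syl i k t) != 1).
Proof.
rewrite -(inj_eq val_inj) -(inj_eq (mulgI (val (fst_syl i j t))^-1)).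
by rewrite mulVg eq_sym.
Qed.

(** A nontrivial turn at the [i]-th vertex prevents cancellation, so the path from [k] to [j] passes
    through [i] and starts like the path to [i]. *)
Lemma fst_syl_turn i j k t : i != k ->
  fst_syl i j t != fst_syl i k t -> fst_syl k j t = fst_syl k i t.
Proof.
move=> ik; rewrite eq_sym fst_syl_neq => ne; apply: val_inj => /=.
rewrite (fst_syl_split i k j t) (syl_mid (i := i) _ ne) ?fst_syl_end ?sylK //.
  by rewrite (syl_rM _ _ (syl_in fs i _)).
by rewrite gpredM ?gpredV ?val_in.
Qed.

Lemma core_split i j k t : i != j -> i != k ->
  (syl j (t j / t i))^-1 * (t j / t k) * syl k (t k / t i) =
  core j i (t j / t i) * ((val (fst_syl i j t))^-1 * val (fst_syl i k t))
    * core i k (t i / t k).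
Proof. by move=> ij ik; rewrite /core !invgF /= !mulgA !mulgK mulgVK. Qed.

(** The path from [j] to [k] passes through [i]. True distances add up; the extra one appears
    because [dist] is half the distance minus one. *)
Lemma dist_turn i j k t : i != j -> i != k ->
  fst_syl i j t != fst_syl i k t ->
  dist j k t = (dist i j t + dist i k t).+1.
Proof.
move=> ij ik ne.
have ek : syl k (t k / t j) = syl k (t k / t i).
  exact: (congr1 val (fst_syl_turn ik ne)).
have ej : syl j (t j / t k) = syl j (t j / t i).
  by apply: (congr1 val (fst_syl_turn ij _)); rewrite eq_sym.
rewrite (distC i j) /dist {1}/core invgF ej ek core_split //.
rewrite fst_syl_neq in ne.
rewrite (len_mid (i := i) _ ne) ?syl_coreV ?syl_core // 1?eq_sym //.
by rewrite gpredM ?gpredV ?val_in.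
Qed.

(** A triangle inequality: if [j] and [k] lie in the same direction from [i], the path between them
    need not visit [i], which saves the one of [dist_turn]. *)
Lemma dist_le i j k t : i != j -> i != k -> j != k ->
  dist j k t <= dist i j t + dist i k t + (fst_syl i j t != fst_syl i k t).
Proof.
move=> ij ik jk.
case: (eqVneq (fst_syl i j t) (fst_syl i k t)) => [e|ne] /=; last first.
  by rewrite addn1 (dist_turn _ _ ne).
rewrite addn0 {1}/dist.
apply: leq_trans (len_core_le _ jk (_ : (syl j (t j / t i))^-1 \in _)
  (syl_in fs k (t k / t i))) _; first by rewrite gpredV syl_in.
rewrite core_split // e mulVg mulg1 (distC i j).
exact: lenM.
Qed.

(* If [a] is the endomorphism that is [x |-> x ^ t j] on [Gs j], then [mv u t]
   describes in the same way [a] preceded by [x |-> x ^ u j] for [j != i]. *)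
Definition mv i (u : I -> subgp (Gs i)) t : I -> G :=
  fun j => if j == i then t i else t j * val (u j) ^ t i.

Lemma mvE i (u : I -> subgp (Gs i)) t j :
  mv u t j = if j == i then t i else t j * val (u j) ^ t i.
Proof. by []. Qed.

Definition leaf i t := [forall j, forall k,
  (j != i) ==> (k != i) ==> (fst_syl i j t == fst_syl i k t)].

Lemma leafP i t : reflect
  (forall j k, j != i -> k != i -> fst_syl i j t = fst_syl i k t) (leaf i t).
Proof.
apply: (iffP forallP) => [ti j k ji ki|ti j].
  by move/forallP: (ti j) => /(_ k); rewrite ji ki => /eqP.
by apply/forallP => k; apply/implyP => ji; apply/implyP => ki; apply/eqP/ti.
Qed.

Definition ell t := \sum_(p : I * I | p.1 != p.2) dist p.1 p.2 t.

Definition gate i t := mv (fun j => fst_syl i j t) t.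

Lemma gateE i t j :
  gate i t j = if j == i then t i else t j * val (fst_syl i j t) ^ t i.
Proof. by []. Qed.

Lemma mv_div i (u : I -> subgp (Gs i)) t j : j != i ->
  mv u t i / mv u t j = (val (u j))^-1 * (t i / t j) * 1.
Proof.
move=> /negPf ji; rewrite /mv eqxx ji invgM -conjVg /conjg.
by rewrite mulgA mulVKg !mulgA mulg1.
Qed.

Lemma fst_syl_mv i (u : I -> subgp (Gs i)) t j : j != i ->
  fst_syl i j (mv u t) = (u j)^-1 * fst_syl i j t.
Proof.
move=> ji; apply: val_inj; rewrite subgpM subgpV /= mv_div // mulg1.
by rewrite [LHS]sylM // gpredV val_in.
Qed.

Lemma dist_mv i (u : I -> subgp (Gs i)) t j : j != i ->
  dist i j (mv u t) = dist i j t.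
Proof.
move=> ji; rewrite /dist mv_div // core_mul 1?eq_sym // ?gpred1 //.
by rewrite gpredV val_in.
Qed.

Lemma mv_div_eq i (u : I -> subgp (Gs i)) t j k : j != i -> k != i ->
  u j = u k -> mv u t j / mv u t k = t j / t k.
Proof. by move=> /negPf ji /negPf ki e; rewrite /mv ji ki e mulgKA. Qed.

Lemma ltn_sum_strict (J : finType) (P : pred J) (a b : J -> nat) z :
  (forall x, P x -> a x <= b x) -> P z -> a z < b z ->
  \sum_(x | P x) a x < \sum_(x | P x) b x.
Proof.
move=> ab Pz ltz; rewrite (bigD1 z) //= [X in _ < X](bigD1 z) //=.
by rewrite -addSn leq_add // leq_sum // => x /andP[/ab].
Qed.

(** Vertices in the same direction from [i] are moved by the same element, so their distance is
    kept. Otherwise their path passed through [i] before the move, whereas afterwards the sharper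
    case of [dist_le] applies. *)
Lemma dist_mv_leaf i (u : I -> subgp (Gs i)) t j k : leaf i (mv u t) ->
  j != i -> k != i -> j != k ->
  dist j k (mv u t) + (fst_syl i j t != fst_syl i k t) <= dist j k t.
Proof.
move=> ui ji ki jk; have /leafP/(_ j k ji ki) e := ui.
case: (eqVneq (fst_syl i j t) (fst_syl i k t)) => ne.
  move: e; rewrite !fst_syl_mv // ne => /mulIg/invg_inj ujk.
  by rewrite /dist mv_div_eq // addn0.
rewrite (dist_turn _ _ ne) 1?eq_sym //= addn1 ltnS.
have := dist_le (mv u t) (_ : i != j) (_ : i != k) jk.
rewrite e eqxx addn0 !dist_mv //; apply; by rewrite eq_sym.
Qed.

Lemma ell_mv_leaf i (u : I -> subgp (Gs i)) t :
  leaf i (mv u t) -> ~~ leaf i t -> ell (mv u t) < ell t.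
Proof.
move=> ui /forallPn[j /forallPn[k]]; rewrite !negb_imply => /and3P[ji ki ne].
have jk : j != k by apply: contraNneq ne => ->.
apply: (@ltn_sum_strict _ _ _ _ (j, k)) => //=; last first.
  by have := dist_mv_leaf ui ji ki jk; rewrite ne addn1.
case=> p q /= pq; case: (eqVneq p i) pq => [->|pi] pq.
  by rewrite dist_mv // eq_sym.
case: (eqVneq q i) pq => [->|qi] pq; first by rewrite !(distC p) dist_mv.
by apply: leq_trans (dist_mv_leaf ui pi qi pq); apply: leq_addr.
Qed.

Lemma fst_syl_gate i t j : j != i -> fst_syl i j (gate i t) = 1.
Proof. by move=> ji; rewrite fst_syl_mv // mulVg. Qed.

Lemma gate_leaf i t : leaf i (gate i t).
Proof. by apply/leafP => j k ji ki; rewrite !fst_syl_gate. Qed.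

(** The gate brings every direction from [i] to 1, and thereby undoes the factors [(u j)^-1] that
    the move put on these directions. *)
Lemma gate_mv i (u : I -> subgp (Gs i)) t : gate i (mv u t) = gate i t.
Proof.
apply/funext => j; rewrite !gateE mvE eqxx; case: eqVneq => // ji.
by rewrite mvE (negPf ji) fst_syl_mv // subgpM subgpV -mulgA -conjMg mulVKg.
Qed.

(** A twist only changes the representatives of the cosets [Gs j * t j], while [trans] below
    translates the whole tree, that is, conjugates all the [Gs j ^ t j] by [g]. *)
Definition twist (a : forall i, subgp (Gs i)) t : I -> G :=
  fun j => val (a j) * t j.
Definition trans t g : I -> G := fun j => t j * g.

Lemma twist_div a t i j :
  twist a t i / twist a t j = val (a i) * (t i / t j) * (val (a j))^-1.
Proof. by rewrite /twist invgM !mulgA. Qed.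

Lemma trans_div t g i j : trans t g i / trans t g j = t i / t j.
Proof. exact: mulgKA. Qed.

Lemma fst_syl_trans t g i j : fst_syl i j (trans t g) = fst_syl i j t.
Proof. by apply: val_inj; rewrite /= trans_div. Qed.

Lemma fst_syl_twist a t i j : i != j ->
  fst_syl i j (twist a t) = a i * fst_syl i j t.
Proof.
move=> ij; apply: val_inj; rewrite subgpM /= twist_div.
rewrite (syl_rM _ _ (_ : _ \in Gs j)) ?gpredV 1?eq_sym //; last exact: val_in.
by rewrite [LHS]sylM ?val_in.
Qed.

(** At a leaf all other vertices are moved by one and the same element. This element stabilizes the
    [i]-th vertex, so the gate is a translation, up to a twist that restores the representative
    [t i]. *)
Lemma gate_of_leaf i j t : leaf i t -> j != i ->
  gate i t = twist (dfwith (fun k => 1 : subgp (Gs k)) (fst_syl i j t)^-1)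
                   (trans t (val (fst_syl i j t) ^ t i)).
Proof.
move=> /leafP ti ji; apply/funext => k; rewrite gateE /twist /trans.
case: (eqVneq k i) => [->|ki].
  by rewrite dfwith_in subgpV conjgE mulVKg mulKg.
by rewrite dfwith_out 1?eq_sym // mul1g (ti k j).
Qed.

Lemma mvK i (u : I -> subgp (Gs i)) t : mv u (mv (fun j => (u j)^-1) t) = t.
Proof.
apply/funext => j; rewrite !mvE eqxx; case: eqVneq => [->//|_].
by rewrite subgpV conjVg mulgVK.
Qed.

(** * Moves of a single vertex, and peaks *)

Definition single i j (x : subgp (Gs i)) : I -> subgp (Gs i) :=
  fun k => if k == j then x else 1.

Lemma mv_single i j (x : subgp (Gs i)) t k : i != j ->
  mv (single j x) t k = if k == j then t j * val x ^ t i else t k.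
Proof.
move=> ij; rewrite mvE /single; case: (eqVneq k i) => [->|ki].
  by rewrite (negPf ij).
by case: eqVneq => [->//|_]; rewrite conj1g mulg1.
Qed.

(** Neither move displaces the vertex that the other one moves or the vertex that the other one
    fixes as its centre; this mirrors relation 2. *)
Lemma mv_singleC i j k l (x : subgp (Gs i)) (y : subgp (Gs k)) t :
  uniq [:: i; j; k; l] ->
  mv (single l y) (mv (single j x) t) = mv (single j x) (mv (single l y) t).
Proof.
rewrite /= !inE !negb_or -!andbA andbT => /and5P[ij ik il jk] /andP[jl kl].
apply/funext => m; rewrite !mv_single //.
rewrite [k == j]eq_sym [l == j]eq_sym (negPf jk) (negPf jl) (negPf il).
by case: (eqVneq m l) => [->|//]; rewrite eq_sym (negPf jl).
Qed.

(** Since [k] sees [l] and [i] in different directions, [i] sees [l] in the direction of [k]. With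
    four vertices only [j] can deviate, and the move turns it towards [k]. *)
Lemma leaf_single i j k l t : uniq [:: i; j; k; l] ->
  (forall m, m \in [:: i; j; k; l]) ->
  fst_syl k l t != fst_syl k i t ->
  leaf i (mv (single j (fst_syl i j t / fst_syl i k t)) t).
Proof.
move=> u cov ne.
move: u; rewrite /= !inE !negb_or -!andbA andbT.
case/and5P=> ij ik il jk /andP[jl kl].
have eil : fst_syl i l t = fst_syl i k t.
  by apply: (fst_syl_turn _ ne); rewrite eq_sym.
suff e m : m != i ->
    fst_syl i m (mv (single j (fst_syl i j t / fst_syl i k t)) t)
    = fst_syl i k t.
  by apply/leafP => m n mi ni; rewrite !e.
move=> mi; rewrite fst_syl_mv // /single; move: (cov m) mi; rewrite !inE.
case/or4P=> /eqP-> => [|_|_|_]; rewrite ?eqxx //.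
- by rewrite invgM invgK mulgVK.
- by rewrite eq_sym (negPf jk) invg1 mul1g.
- by rewrite eq_sym (negPf jl) invg1 mul1g eil.
Qed.

(** The distances from [i] to [l] and from [k] to [j] fall strictly, by [dist_mv_leaf] at [k] and at
    [i], and no other distance grows. *)
Lemma ell_peak i j k l t : uniq [:: i; j; k; l] ->
  (forall m, m \in [:: i; j; k; l]) ->
  fst_syl i j t != fst_syl i k t -> fst_syl k l t != fst_syl k i t ->
  ell (mv (single l (fst_syl k l t / fst_syl k i t))
          (mv (single j (fst_syl i j t / fst_syl i k t)) t)) < ell t.
Proof.
move=> u cov ne1 ne2.
have u' : uniq [:: k; l; i; j] by rewrite -(rot_uniq 2).
have cov' m : m \in [:: k; l; i; j] by rewrite -(mem_rot 2).
have l1 := leaf_single u cov ne2; have l2 := leaf_single u' cov' ne1.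
set x := _ / _ in l1 *; set y := _ / _ in l2 *.
move: (mv_singleC x y t u) l1 l2.
set s := mv _ t; set s' := mv (single l y) t; set t' := mv _ s => t'E l1 l2.
have := u; rewrite /= !inE !negb_or -!andbA andbT.
case/and5P=> ij ik il jk /andP[jl kl].
have ji : j != i by rewrite eq_sym.
have ki : k != i by rewrite eq_sym.
have li : l != i by rewrite eq_sym.
have lk : l != k by rewrite eq_sym.
have dj : dist i j t' = dist i j t.
  rewrite t'E dist_mv // /dist /s' !mv_single //.
  by rewrite (negPf il) (negPf jl).
have dk : dist i k t' = dist i k t.
  rewrite t'E dist_mv // /dist /s' !mv_single //.
  by rewrite (negPf il) (negPf kl).
have dl : dist i l t' < dist i l t.
  rewrite t'E dist_mv //.
  have := dist_mv_leaf l2 lk ik li; rewrite ne2 addn1 distC.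
  by rewrite [dist l i t]distC.
have dkj : dist k j t' < dist k j t.
  rewrite /t' dist_mv //; have := dist_mv_leaf l1 ji ki jk; rewrite ne1 addn1.
  by rewrite distC [dist j k t]distC.
have dkl : dist k l t' = dist k l t.
  rewrite /t' dist_mv // /dist /s !mv_single // eq_sym (negPf jk).
  by rewrite eq_sym (negPf jl).
(* In [t] the path from [j] to [l] passes through [i], which is the worst case of [dist_le]; in [t']
   the distances to [i] have not grown. *)
have djl : dist j l t' <= dist j l t.
  have eil : fst_syl i l t = fst_syl i k t by apply: fst_syl_turn.
  have ne3 : fst_syl i j t != fst_syl i l t by rewrite eil.
  rewrite (dist_turn ij il ne3); apply: leq_trans (dist_le _ ij il jl) _.
  rewrite dj; apply: leq_trans (leq_add (leqnn _) (leq_b1 _)) _.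
  by rewrite addn1 ltnS leq_add2l ltnW.
apply: (@ltn_sum_strict _ _ _ _ (i, l)) => //.
case=> p q /=; move: (cov p) (cov q); rewrite !inE.
have le m n : dist m n t' <= dist m n t -> dist n m t' <= dist n m t.
  by rewrite distC [dist n m t]distC.
have {}dj : dist i j t' <= dist i j t by rewrite dj.
have {}dk : dist i k t' <= dist i k t by rewrite dk.
have {}dkl : dist k l t' <= dist k l t by rewrite dkl.
have {}dl := ltnW dl; have {}dkj := ltnW dkj.
by case/or4P=> /eqP-> /or4P[] /eqP->; rewrite ?eqxx // => _; auto.
Qed.

(** This is the subgroup generated by the [Gs i ^ t i]; inverses are covered because each [Gs i]
    contains those of its elements. *)
Inductive gen t : G -> Prop :=
| gen1 : gen t 1
| genM i x g : x \in Gs i -> gen t g -> gen t (x ^ t i * g).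

Definition generating t := forall g, gen t g.

Lemma gen_mul t g h : gen t g -> gen t h -> gen t (g * h).
Proof.
move=> gg gh; elim: gg => [|i x {}g xG _ IHg]; first by rewrite mul1g.
by rewrite -mulgA; apply: genM.
Qed.

Lemma gen_in t i x : x \in Gs i -> gen t (x ^ t i).
Proof. by move=> xG; rewrite -[_ ^ _]mulg1; apply: genM xG (gen1 t). Qed.

Lemma generating_sub t t' :
  (forall i x, x \in Gs i -> gen t' (x ^ t i)) ->
  generating t -> generating t'.
Proof.
move=> tt' tg g; elim: {g}(tg g) => [|i x g xG _ IHg]; first exact: gen1.
by apply: gen_mul IHg; apply: tt'.
Qed.

(** The [i]-th conjugate is unchanged and contains the elements by which the others get conjugated,
    so the old conjugates are recovered from the new ones. *)
Lemma generating_mv i (u : I -> subgp (Gs i)) t :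
  generating t -> generating (mv u t).
Proof.
apply: generating_sub => j x; case: (eqVneq j i) => [->|ji] xG.
  by move: (gen_in (mv u t) xG); rewrite mvE eqxx.
have uG : val (u j) \in Gs i by apply: val_in.
have := gen_in (mv u t) uG; rewrite mvE eqxx => gu.
have gVu : gen (mv u t) (val (u j) ^ t i)^-1.
  have := gen_in (mv u t) (_ : (val (u j))^-1 \in Gs i).
  by rewrite mvE eqxx conjVg; apply; rewrite gpredV.
have -> : x ^ t j = val (u j) ^ t i * (x ^ mv u t j * (val (u j) ^ t i)^-1).
  have E (y z : G) : y * (z ^ y / y) = z.
    by rewrite conjgE !mulgA mulgV mul1g mulgK.
  by rewrite mvE (negPf ji) conjgM E.
by apply: gen_mul gu (gen_mul (gen_in _ xG) gVu).
Qed.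

Lemma generating_twist a t : generating t -> generating (twist a t).
Proof.
apply: generating_sub => i x xG.
rewrite -[x](conjgKV (val (a i))) -conjgM; apply: gen_in.
by rewrite gpredM ?gpredM ?gpredV ?gpredV ?val_in // ?invgK.
Qed.

Lemma generating_trans t g : generating t -> generating (trans t g).
Proof.
move=> tg h; rewrite -[h](conjgKV g).
elim: {h}(tg (h ^ g^-1)) => [|i x h xG _ IHh]; first by rewrite conj1g; apply: gen1.
by rewrite conjMg -conjgM; apply: genM.
Qed.

(** * Generating tuples in which every vertex is a leaf *)

Section Leaves.
Variable t : I -> G.

Definition conj_hom : {hom G -> G} :=
  ext fs (fun i => (inner (t i) \o incl (Gs i) : {hom subgp (Gs i) -> G})).

Lemma conj_homE i x : x \in Gs i -> conj_hom x = x ^ t i.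
Proof. by move=> xG; rewrite [LHS](extE fs _ (Subgp xG)). Qed.

Hypothesis tg : generating t.
Hypothesis t1 : forall i j, i != j -> syl i (t i / t j) = 1.
Variable o : I.
Hypothesis to : t o = 1.

Let syl_t i : syl i (t i) = 1.
Proof.
have [->|io] := eqVneq i o; first by rewrite to syl1.
by have := t1 io; rewrite to divg1.
Qed.

(* No cancellation occurs when the conjugates [x ^ t i] of the syllables of a
   nonempty reduced word are multiplied. *)
Lemma conj_hom_reduced i x w : reduced Gs ((i, x) :: w) ->
  exists2 m, syl i m = 1 & conj_hom (wprod ((i, x) :: w)) = (t i)^-1 * x * m.
Proof.
elim: w i x => [|[j y] w IHw] i x.
  rewrite reduced_cons => /and4P[xG _ _ _]; exists (t i) => //.
  by rewrite /wprod big_seq1 (conj_homE xG) conjgE mulgA.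
rewrite reduced_cons => /and4P[xG x1 yi wr].
have [m mj e] := IHw _ _ wr; exists (t i / t j * y * m).
  move: wr; rewrite reduced_cons => /and4P[yG y1 _ _].
  move: yi; rewrite /=; case: (eqVneq j i) => [_|ji _].
    by rewrite (negPf y1).
  by rewrite (syl_mid yG) ?t1 // 1?eq_sym // invgF t1.
by rewrite wprod_cons gmulfM e (conj_homE xG) conjgE !mulgA.
Qed.

(** A nontrivial [y] in [Gs k] is a value of [conj_hom], so its one-letter normal form contains that
    of [(t i)^-1] followed by a letter of factor [i]. Hence [t i] is trivial and [i = k]. *)
Lemma all_leaves_standard k :
  (exists2 x, x \in Gs k & x != 1) -> t k = 1.
Proof.
have [->//|ko] := eqVneq k o.
case=> y yG y1.
have [h hy] : exists h, conj_hom h = y.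
  elim: {y yG y1}(tg y) => [|i x y xG _ [h hy]]; first by exists 1; rewrite gmulf1.
  by exists (x * h); rewrite gmulfM hy (conj_homE xG).
have hr := nf_reduced fs h; move: hy; rewrite -[h](nfK fs).
case: (nf fs h) hr => [_|[i x] w wr].
  by rewrite /wprod big_nil gmulf1 => e; rewrite -e eqxx in y1.
have [m mi ->] := conj_hom_reduced wr.
move: wr; rewrite reduced_cons => /and4P[xG x1 _ _] e.
have : nf fs y = nf fs (t i)^-1 ++ (i, x) :: nf fs m.
  by rewrite -e (nf_mid xG) // invgK.
rewrite (nf_in fs yG y1).
case E: (nf fs (t i)^-1) => [|a [|b v]] //= -[-> _ _].
by apply: invg_inj; rewrite invg1; apply: (@len0 _ _ _ fs); rewrite /len E.
Qed.

End Leaves.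

Lemma all_leaves t (other : I -> I) (o : I) :
  (forall i, other i != i) -> (forall i, exists2 x, x \in Gs i & x != 1) ->
  generating t -> (forall i, leaf i t) -> exists a g, t = twist a (fun=> g).
Proof.
move=> oi nontriv tg tl; pose a i := fst_syl i (other i) t.
pose g := val (a o)^-1 * t o.
(* The twist brings the single direction seen from each leaf to 1, and the translation makes the
   [o]-th entry trivial. *)
exists a, g; pose t' := trans (twist (fun i => (a i)^-1) t) g^-1.
suff t'1 i : t' i = 1.
  apply/funext => i; have := t'1 i; rewrite /t' /trans /twist => /divg1_eq e.
  by rewrite -e subgpV mulVKg.
apply: (@all_leaves_standard t' _ _ o) => //.
- exact/generating_trans/generating_twist.
- move=> j k jk; have := fst_syl_twist (fun i => (a i)^-1) t jk.
  rewrite -(fst_syl_trans _ g^-1) /a.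
  move/leafP: (tl j) => /(_ (other j) k (oi j)) ->; last by rewrite eq_sym.
  by rewrite mulVg => /(congr1 val).
- by rewrite /t' /trans /twist mulgV.
Qed.

End Tuples.

(** * Descent in the presented group *)

(** Each [B j] only has to pass factors [A k] of later indices, which differ from [j] because [r]
    has no repetition. *)
Lemma prodgM_disjoint (H : groupType) (J : eqType) (r : seq J) (A B : J -> H) :
  uniq r -> (forall j k, j != k -> commute (A j) (B k)) ->
  \prod_(j <- r) (A j * B j) = (\prod_(j <- r) A j) * \prod_(j <- r) B j.
Proof.
move=> + AB; elim: r => [|j r IHr] /=; first by rewrite !big_nil mulg1.
move=> /andP[jr /IHr]; rewrite !big_cons => ->.
rewrite -!mulgA; congr (_ * _); rewrite !mulgA; congr (_ * _).
rewrite big_seq; apply: commute_prod => k kr; apply/commute_sym/AB.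
by apply: contraNneq jr => <-.
Qed.

Lemma mem_full (T : finType) (s : seq T) : uniq s -> size s = #|T| ->
  forall x, x \in s.
Proof.
move=> us ss x; have /subset_leqif_cards : [set y in s] \subset [set: T].
  exact: subsetT.
rewrite cardsE (card_uniqP us) cardsT ss => -[_]; rewrite eqxx => /esym/eqP e.
by have := in_setT x; rewrite -e inE.
Qed.

Section Descent.
Variables (G : groupType) (Gs : 'I_4 -> groupClosed G).
Hypothesis fs : free_splitting Gs.
Hypothesis nontrivial : forall i, exists2 x, x \in Gs i & x != 1.
Implicit Types (i j k l : 'I_4) (t : 'I_4 -> G).

Local Notation leaf := (leaf fs).
Local Notation gate := (gate fs).
Local Notation ell := (ell fs).
Local Notation fst_syl := (fst_syl fs).

(** [P] is any group with elements satisfying the four relations. The family [f] is extended by 1 to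
    the diagonal, so that products can run over all four indices. *)
Variables (P : groupType) (f : forall i, 'I_4 -> subgp (Gs i) -> P).
Variable p : Phi Gs -> P.
Hypothesis f_diag : forall i (x : subgp (Gs i)), f i x = 1.
Hypothesis fM : forall i j, {morph (@f i j) : x y / x * y}.
Hypothesis pM : {morph p : x y / x * y}.
Hypothesis f_commute : forall i j k (x y : subgp (Gs i)), j != k ->
  commute (f j x) (f k y).
Hypothesis f_commute4 : forall i j k l (x : subgp (Gs i)) (y : subgp (Gs k)),
  uniq [:: i; j; k; l] -> commute (f j x) (f l y).
Hypothesis f_Ad : forall i (x : subgp (Gs i)), \prod_j f j x = p (Ad x).
Hypothesis fJ : forall i j (x : subgp (Gs i)) phi,
  f j x ^ p phi = f j (phi i x).

Definition whitehead i (u : 'I_4 -> subgp (Gs i)) : P := \prod_j f j (u j).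

Lemma f1 i j : f j (1 : subgp (Gs i)) = 1.
Proof. by apply: (mulgI (f j (1 : subgp (Gs i)))); rewrite -fM !mulg1. Qed.

Lemma whiteheadM i (u v : 'I_4 -> subgp (Gs i)) :
  whitehead (fun j => u j * v j) = whitehead u * whitehead v.
Proof.
rewrite -prodgM_disjoint ?index_enum_uniq //.
  by apply: eq_bigr => j _; rewrite fM.
by move=> j k jk; apply: f_commute.
Qed.

Lemma eq_whitehead i (u v : 'I_4 -> subgp (Gs i)) :
  (forall j, j != i -> u j = v j) -> whitehead u = whitehead v.
Proof.
move=> uv; apply: eq_bigr => j _; have [->|ji] := eqVneq j i.
  by rewrite !f_diag.
by rewrite uv.
Qed.

Lemma whitehead_single i j (x : subgp (Gs i)) :
  whitehead (single j x) = f j x.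
Proof.
have -> : f j x = \prod_(k | k == j) f k x by rewrite big_pred1_eq.
rewrite big_mkcond.
by apply: eq_bigr => k _; rewrite /single; case: ifP => //; rewrite f1.
Qed.

Lemma whiteheadJ i (u : 'I_4 -> subgp (Gs i)) phi :
  whitehead u ^ p phi = whitehead (fun j => phi i (u j)).
Proof. by rewrite /whitehead conjg_prod; apply: eq_bigr => j _; rewrite fJ. Qed.

Definition Ads (a : forall i, subgp (Gs i)) : Phi Gs := fun i => inner (a i).

Definition upd1 i (x : subgp (Gs i)) : forall k, subgp (Gs k) :=
  dfwith (fun k => 1 : subgp (Gs k)) x.

Lemma Ads_upd1 i (x : subgp (Gs i)) : Ads (upd1 x) = Ad x.
Proof.
apply: functional_extensionality_dep => k; rewrite /Ads /upd1 /Ad.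
by case: dfwithP => [|j ij]; rewrite ?dfwith_in // dfwith_out // gmulf1.
Qed.

(* [q] is read off a path of gates from the basis [Gs i ^ t i] down to a
   conjugate of the standard one, so that its image in [Out G] is the class of
   the automorphism that is [x |-> x ^ t i] on each [Gs i]. *)
Inductive descent : ('I_4 -> G) -> P -> Prop :=
| descent_base a g : descent (twist a (fun=> g)) (p (Ads a))
| descent_step i t q : ~~ leaf i t -> descent (gate i t) q ->
    descent t (whitehead (fun j => fst_syl i j t) * q).

Lemma descentP t q : descent t q ->
  (exists a g, t = twist a (fun=> g) /\ q = p (Ads a)) \/
  (exists i q', [/\ ~~ leaf i t, descent (gate i t) q' &
     q = whitehead (fun j => fst_syl i j t) * q']).
Proof.
by case=> [a g|i t' q' lt' dt']; [left; exists a, g | right; exists i, q'].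
Qed.

(** * Descents under twists and translations *)

Lemma twist_mul (a b : forall i, subgp (Gs i)) t :
  twist a (twist b t) = twist (fun i => a i * b i) t.
Proof. by apply/funext => j; rewrite /twist subgpM mulgA. Qed.

Lemma AdsM (a b : forall i, subgp (Gs i)) :
  Ads (fun i => a i * b i) = Ads a * Ads b.
Proof.
by apply: functional_extensionality_dep => i; rewrite /Ads gmulfM.
Qed.

Lemma eq_leaf i t t' :
  (forall j k, j != i -> k != i ->
    (fst_syl i j t == fst_syl i k t) = (fst_syl i j t' == fst_syl i k t')) ->
  leaf i t = leaf i t'.
Proof.
move=> tt'; apply: eq_forallb => j; apply: eq_forallb => k.
by case: eqVneq => //= ji; case: eqVneq => //= ki; rewrite tt'.
Qed.

Lemma leaf_trans i t g : leaf i (trans t g) = leaf i t.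
Proof. by apply: eq_leaf => j k _ _; rewrite !fst_syl_trans. Qed.

Lemma leaf_twist i (a : forall i, subgp (Gs i)) t :
  leaf i (twist a t) = leaf i t.
Proof.
apply: eq_leaf => j k ji ki; rewrite !fst_syl_twist 1?eq_sym //.
by apply/eqP/eqP => [/mulgI//|->].
Qed.

Lemma gate_trans i t g : gate i (trans t g) = trans (gate i t) g.
Proof.
apply/funext => j; rewrite /trans !gateE; case: ifP => // _.
rewrite -/(trans t g) fst_syl_trans conjgM.
by rewrite [X in _ * _ * X]conjgE mulgA mulgK mulgA.
Qed.

(** A twist at [i] multiplies all directions from [i] by [a i], which the gate compensates by a
    translation; twists at the other vertices commute with the gate. *)
Lemma gate_twist i (a : forall i, subgp (Gs i)) t :
  gate i (twist a t) =
  trans (twist (fun k => if k == i then 1 else a k) (gate i t))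
        (val (a i) ^ t i).
Proof.
apply/funext => j; rewrite /trans /twist !gateE; case: eqVneq => [->|ji].
  by rewrite mul1g conjgE mulVKg.
rewrite -/(twist a t) fst_syl_twist 1?eq_sym // subgpM conjgM.
have E (x y : G) : (x * y) ^ x = y * x by rewrite conjgE -mulgA mulKg.
by rewrite E conjMg !mulgA.
Qed.

Lemma descent_trans t q g : descent t q -> descent (trans t g) q.
Proof.
elim=> {t q} [a h|i t q lt _ IHt].
  rewrite (_ : trans _ _ = twist a (fun=> h * g)); first exact: descent_base.
  by apply/funext => j; rewrite /trans /twist mulgA.
have := @descent_step i (trans t g) q; rewrite leaf_trans gate_trans.
by under [fun j => _]funext => j do rewrite fst_syl_trans; apply.
Qed.

Lemma whitehead_const i (x : subgp (Gs i)) :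
  whitehead (fun=> x) = p (Ads (upd1 x)).
Proof. by rewrite Ads_upd1 -f_Ad. Qed.

(** At a step through [i], the component of [a] at [i] yields a constant Whitehead element, which
    relation 3 turns into [Ad]. The other components act trivially on [Gs i], so relation 4 moves
    them across. *)
Lemma descent_twist t q (a : forall i, subgp (Gs i)) :
  descent t q -> descent (twist a t) (p (Ads a) * q).
Proof.
move=> dt; elim: dt a => {t q} [b g|i t q lt _ IHt] a.
  by rewrite twist_mul -pM -AdsM; apply: descent_base.
pose a' := fun k => if k == i then 1 else a k.
have : descent (gate i (twist a t)) (p (Ads a') * q).
  by rewrite gate_twist; apply: descent_trans.
move=> /descent_step; rewrite leaf_twist => /(_ lt).
rewrite (eq_whitehead (v := fun j => a i * fst_syl i j t)); last first.
  by move=> j ji; rewrite fst_syl_twist // eq_sym.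
rewrite whiteheadM whitehead_const -[X in descent _ X]mulgA.
set F := whitehead _; have -> : F * (p (Ads a') * q) = p (Ads a') * (F * q).
  rewrite !mulgA [F * _]conjgC whiteheadJ; congr (_ * _ * _).
  by apply: eq_whitehead => j _; rewrite /Ads /a' eqxx gmulf1.
rewrite mulgA -pM -AdsM (_ : (fun i0 => _) = a) //.
apply: functional_extensionality_dep => k; rewrite /upd1 /a'.
case: dfwithP => [|j ij]; first by rewrite eqxx mulg1.
by rewrite eq_sym (negPf ij) mul1g.
Qed.

Definition other i : 'I_4 := if i == ord0 then ord_max else ord0.

Lemma other_neq i : other i != i.
Proof. by rewrite /other; case: (eqVneq i ord0) => [->|]; rewrite 1?eq_sym. Qed.

(** At a leaf the Whitehead element is constant, hence given by relation 3, and the gate is [t] up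
    to twist and translation; [descent_twist] then replaces the missing step. *)
Lemma descent_gate i t q : descent (gate i t) q ->
  descent t (whitehead (fun j => fst_syl i j t) * q).
Proof.
case: (boolP (leaf i t)) => [ti|]; last exact: descent_step.
pose e := fst_syl i (other i) t.
rewrite (eq_whitehead (v := fun=> e)); last first.
  by move=> j ji; move/leafP: ti; apply=> //; apply: other_neq.
rewrite whitehead_const (gate_of_leaf ti (other_neq i)) -/e.
move=> /(descent_twist (upd1 e)); rewrite twist_mul.
move=> /(descent_trans (val e ^ t i)^-1).
rewrite (_ : trans _ (_ ^ _)^-1 = t) //; apply/funext => j.
rewrite /trans /twist /upd1; set z := dfwith _ _ _ * _.
suff -> : z = 1 by rewrite mul1g mulgK.
rewrite /z.
case: dfwithP => [|k ik]; first by rewrite dfwith_in mulgV.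
by rewrite dfwith_out // mulg1.
Qed.

Lemma descent_ex t : generating Gs t -> exists q, descent t q.
Proof.
have [n] := ubnP (ell t); elim: n t => // n IHn t tn tg.
case: (boolP [forall i, leaf i t]) => [/forallP tl|/forallPn[i lt]].
  have [a [g ->]] := all_leaves ord0 other_neq nontrivial tg tl.
  by exists (p (Ads a)); apply: descent_base.
have [||q dq] := IHn (gate i t).
- apply: leq_trans (ell_mv_leaf _ lt) _; first exact: gate_leaf.
  by rewrite -ltnS.
- exact: generating_mv.
by exists (whitehead (fun j => fst_syl i j t) * q); apply: descent_step.
Qed.

(** * Independence of the chosen descent *)

Definition unique_descent t :=
  forall q q', descent t q -> descent t q' -> q = q'.

(** Both tuples have the same gate at [i]. A descent from this gate extends to each of them, and
    uniqueness at [mv u t] identifies one extension with the given [q]. *)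
Lemma descent_mv i (u : 'I_4 -> subgp (Gs i)) t q :
  unique_descent (mv u t) -> generating Gs t ->
  descent (mv u t) q -> descent t (whitehead u * q).
Proof.
move=> uniq_mv tg dq; have [|m dm] := @descent_ex (gate i t).
  exact: generating_mv.
have := dm; rewrite -(gate_mv fs u) => /descent_gate /(uniq_mv _ _ dq) ->.
rewrite mulgA -whiteheadM.
rewrite (eq_whitehead (v := fun j => fst_syl i j t)); first exact: descent_gate.
by move=> j ji; rewrite fst_syl_mv // mulVKg.
Qed.

(** The tuple [mv (single j x) t] has smaller complexity, and its gate at [i] is that of [t].
    Uniqueness there equates the descent through this gate with the one through the second single
    move. *)
Lemma descent_peak i j k l t q qy :
  (forall t', ell t' < ell t -> generating Gs t' -> unique_descent t') ->
  generating Gs t -> uniq [:: i; j; k; l] ->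
  fst_syl i j t != fst_syl i k t -> fst_syl k l t != fst_syl k i t ->
  let x := fst_syl i j t / fst_syl i k t in
  let y := fst_syl k l t / fst_syl k i t in
  descent (gate i t) q -> descent (mv (single l y) (mv (single j x) t)) qy ->
  whitehead (fun m => fst_syl i m t) * q = f j x * (f l y * qy).
Proof.
move=> IHt tg u ne1 ne2 x y dq dqy; have cov := mem_full u (esym (card_ord 4)).
have zl : leaf i (mv (single j x) t) by apply: leaf_single ne2.
have lt : ~~ leaf i t.
  apply: contra ne1 => /leafP e; apply/eqP; move: u.
  by rewrite /= !inE !negb_or -!andbA => /and3P[ij ik _]; apply: e; rewrite eq_sym.
have zg : generating Gs (mv (single j x) t) by apply: generating_mv.
have := dq; rewrite -(gate_mv fs (single j x)) => /descent_gate dz1.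
have dz2 : descent (mv (single j x) t) (f l y * qy).
  rewrite -whitehead_single; apply: descent_mv => //; apply: IHt.
    exact: ell_peak.
  exact: generating_mv.
have <- := IHt _ (ell_mv_leaf zl lt) zg _ _ dz1 dz2.
rewrite mulgA -whitehead_single -whiteheadM; congr (_ * _).
by apply: eq_whitehead => m mi; rewrite fst_syl_mv // mulVKg.
Qed.

Lemma not_leaf i k t : k != i -> ~~ leaf i t ->
  exists2 j, j != i & fst_syl i j t != fst_syl i k t.
Proof.
move=> ki; case: (boolP [exists j, (j != i) && (fst_syl i j t != fst_syl i k t)]).
  by move=> /existsP[j /andP[ji ne]]; exists j.
move=> /existsPn none /negP[]; apply/leafP => m n mi ni.
by have := none m; have := none n; rewrite mi ni /= !negbK => /eqP-> /eqP.
Qed.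

Lemma descent_unique t : generating Gs t -> unique_descent t.
Proof.
have [n] := ubnP (ell t); elim: n t => // n IHn t tn tg q q'.
have {}IHn t' : ell t' < ell t -> generating Gs t' -> unique_descent t'.
  by move=> tt'; apply: IHn; apply: leq_trans tt' _; rewrite -ltnS.
have base_leaf i (a : forall i, subgp (Gs i)) g : leaf i (twist a (fun=> g)).
  rewrite leaf_twist; apply/leafP => j k _ _; apply: val_inj.
  by rewrite /= mulgV.
case/descentP=> [[a [g [ta ->]]]|[i [r [li dr ->]]]];
  case/descentP=> [[b [h [tb ->]]]|[k [s [lk ds ->]]]].
(* The twist is recovered from the tuple, since [a i] is the direction from [i] to any other
   vertex. *)
- congr (p (Ads _)); apply: functional_extensionality_dep => i.
  have fst_syl_const z : fst_syl i (other i) (fun=> z) = 1.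
    by apply: val_inj; rewrite /= mulgV syl1.
  have : fst_syl i (other i) (twist a (fun=> g)) =
         fst_syl i (other i) (twist b (fun=> h)) by rewrite -ta -tb.
  by rewrite !fst_syl_twist 1?eq_sym ?other_neq // !fst_syl_const !mulg1.
- by rewrite ta base_leaf in lk.
- by rewrite tb base_leaf in li.
have [ki|ki] := eqVneq k i.
  move: ki lk ds => -> _ ds; congr (_ * _).
  apply: IHn dr ds; last exact: generating_mv.
  by apply: ell_mv_leaf => //; apply: gate_leaf.
have ik : i != k by rewrite eq_sym.
have [j ji ne1] := not_leaf ki li.
have [l lk' ne2] := not_leaf ik lk.
have jk : j != k by apply: contraNneq ne1 => ->.
have li' : l != i by apply: contraNneq ne2 => ->.
(* As [i] sees [j] and [k] in different directions, [k] sees [j] in the direction of [i], unlike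
   [l]. *)
have jl : j != l.
  apply: contraNneq ne2 => <-; apply/eqP; exact: fst_syl_turn.
have u : uniq [:: i; j; k; l].
  rewrite /= !inE !negb_or ik jk jl ![i == _]eq_sym ji li'.
  by rewrite eq_sym lk'.
have u' : uniq [:: k; l; i; j] by rewrite -(rot_uniq 2).
pose x := fst_syl i j t / fst_syl i k t.
pose y := fst_syl k l t / fst_syl k i t.
(* A descent from the tuple reached by both single moves, in either order, is compared with both
   given descents. *)
have [|qy dqy] := @descent_ex (mv (single l y) (mv (single j x) t)).
  exact/generating_mv/generating_mv.
rewrite (descent_peak IHn tg u ne1 ne2 dr dqy).
rewrite mv_singleC // in dqy.
rewrite (descent_peak IHn tg u' ne2 ne1 ds dqy) !mulgA; congr (_ * _).
exact: f_commute4.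
Qed.

End Descent.

(** * The relations hold *)

Lemma fprodg_ind (I : choiceType) (K : I -> groupType)
    (Q : fprodg K -> Prop) :
  Q 1 -> (forall i (x : K i) w, Q w -> Q (fprodg_in x * w)) -> forall w, Q w.
Proof.
move=> Q1 QM w; rewrite -[w]reprK; elim: (repr w) => [//|[i x] u IHu].
have -> : \pi_(fprodg K) (Tagged (fun i => K i) x :: u) =
    fprodg_in x * \pi_(fprodg K) u by rewrite [RHS]fprodg_mulE.
exact: QM.
Qed.

Section QuotientLift.
Variables (F H : groupType) (R : F -> Prop) (phi : {hom F -> H}).

Definition quot_lift of (forall w, R w -> phi w = 1) :=
  fun a : quot (ncl R) => phi (repr a).

Hypothesis phiR : forall w, R w -> phi w = 1.

Lemma quot_liftE w : quot_lift phiR (quot_pi (ncl R) w) = phi w.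
Proof.
rewrite /quot_lift /quot_pi; case: piP => v /eq_quotP /asboolP wv.
suff : phi (w / v) = 1 by rewrite gmulfF => /divg1_eq.
elim: {w v}(w / v) / wv => [w /phiR//||x y _ Rx _ Ry|x _ Rx|x y _ Rx].
- exact: gmulf1.
- by rewrite gmulfM Rx Ry mulg1.
- by rewrite gmulfV Rx invg1.
- by rewrite gmulfJ Rx conj1g.
Qed.

Lemma quot_lift_morph : monoid_morphism (quot_lift phiR).
Proof.
split=> [|a b]; first by rewrite -[1]/(quot_pi (ncl R) 1) quot_liftE gmulf1.
rewrite -[a]reprK -[b]reprK -!/(quot_pi (ncl R) _) -gmulfM.
by rewrite !quot_liftE gmulfM.
Qed.

HB.instance Definition _ :=
  isUMagmaMorphism.Build (quot (ncl R)) H (quot_lift phiR) quot_lift_morph.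

End QuotientLift.

Lemma out_class_inner (G : groupType) (g : G) : out_class (inner g) = 1.
Proof.
apply/eq_quotP; rewrite invg1 mulg1; apply/asboolP; by exists g.
Qed.

Lemma out_class_eq1 (G : groupType) (a : aut G) :
  out_class a = 1 -> exists g, a = inner g.
Proof. by move=> /eq_quotP; rewrite invg1 mulg1 => /asboolP. Qed.

Lemma ex_notin (T : finType) (s : seq T) : size s < #|T| -> exists x, x \notin s.
Proof.
move=> ss; apply/existsP; apply: contraTT ss => /existsPn sT; rewrite -leqNgt.
apply: leq_trans (card_size s); apply/subset_leq_card/subsetP => x _.
by have := sT x; rewrite negbK.
Qed.

Lemma set4_full (i j k l : 'I_4) :
  [set i; j; k; l]%SET = [set: 'I_4]%SET <-> uniq [:: i; j; k; l].
Proof.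
split=> [e|u].
  apply/card_uniqP; rewrite -[RHS](card_ord 4) -cardsT -e.
  by apply: eq_card => x; rewrite !inE !orbA.
apply/setP => x; have := mem_full u (esym (card_ord 4)) x.
by rewrite !inE !orbA.
Qed.

Section Splitting.
Variables (I : choiceType) (G : groupType) (Gs : I -> groupClosed G).
Hypothesis fs : free_splitting Gs.

(** Values are taken in [Out G], where classes can be computed from representatives without carrying
    proofs of purity. *)
Definition out_eval : {hom fprodg (gen_group fs) -> Out G} :=
  incl (pure_sym Gs) \o fprodg_lift (gen_hom fs).

Lemma out_eval_f i j (ij : i != j) (g : subgp (Gs i)) :
  out_eval (gen_f fs ij g) = out_class (pconj fs j g).
Proof. by rewrite /out_eval /= fprodg_lift_in. Qed.

Lemma out_eval_Phi phi :
  out_eval (gen_Phi fs phi) = out_class (factor_aut fs phi).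
Proof. by rewrite /out_eval /= fprodg_lift_in. Qed.

(** The moved factors differ and neither contains the other's conjugator. This covers relation 2
    and, with [k = i], relation 1. *)
Lemma pconj_commute i j k l (g : subgp (Gs i)) (h : subgp (Gs k)) :
  j != l -> i != l -> k != j -> commute (pconj fs j g) (pconj fs l h).
Proof.
move=> /negPf jl /negPf il /negPf kj; apply: (aut_splitting_eq fs) => m.
have lj : (l == j) = false by rewrite eq_sym jl.
have [->|/negPf mj] := eqVneq m j => x.
  by rewrite !autME !pconjE jl eqxx autJ aut_funV !pconjE jl il eqxx.
move: x; have [->|/negPf ml] := eqVneq m l => x.
  by rewrite !autME !pconjE lj eqxx autJ aut_funV !pconjE lj kj eqxx.
by rewrite !autME !pconjE ml mj !pconjE ml mj.
Qed.

Lemma pconj_id i j (g : subgp (Gs i)) m (x : subgp (Gs m)) :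
  m != j -> pconj fs j g (val x) = val x.
Proof. by move=> /negPf mj; rewrite pconjE mj. Qed.

Lemma pconj_act i j (g : subgp (Gs i)) (x : subgp (Gs j)) :
  pconj fs j g (val x) = val x ^ (val g)^-1.
Proof. by rewrite pconjE eqxx. Qed.

Lemma pconj_idJ i j (g h : subgp (Gs i)) m (x : subgp (Gs m)) :
  m != j -> i != j -> pconj fs j g (val x ^ (val h)^-1) = val x ^ (val h)^-1.
Proof. by move=> mj ij; rewrite autJ aut_funV !pconj_id. Qed.

Lemma pconj_factor_aut i j (g : subgp (Gs i)) phi :
  pconj fs j g ^ factor_aut fs phi = pconj fs j (phi i g).
Proof.
rewrite /conjg; apply: (canLR (mulKg _)).
apply: (aut_splitting_eq fs) => m x.
rewrite !autME factor_autE !pconjE; case: ifP => _; last exact: factor_autE.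
by rewrite autJ aut_funV !factor_autE.
Qed.

End Splitting.

Section Relations.
Variables (G : groupType) (Gs : 'I_4 -> groupClosed G).
Hypothesis fs : free_splitting Gs.

Lemma aut_mul3 (a b c : aut G) x y1 y2 y3 :
  a x = y1 -> b y1 = y2 -> c y2 = y3 -> (a * b * c) x = y3.
Proof. by rewrite !autME => -> -> ->. Qed.

(** The left side fixes [Gs i] and conjugates the three other factors by [g]; conjugating all four
    exceeds this by [Ad g] on [Gs i]. The inner factor vanishes in [Out G]. *)
Lemma pconj_Ad i j k l (g : subgp (Gs i)) :
  uniq [:: i; j; k; l] ->
  pconj fs j g * pconj fs k g * pconj fs l g
    = factor_aut fs (Ad g) * inner (val g)^-1.
Proof.
move=> u; have cov := mem_full u (esym (card_ord 4)).
move: u; rewrite /= !inE !negb_or -!andbA andbT.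
case/and5P=> ij ik il jk /andP[jl kl].
have kj : k != j by rewrite eq_sym.
have lj : l != j by rewrite eq_sym.
have lk : l != k by rewrite eq_sym.
apply: (aut_splitting_eq fs) => m; move: (cov m); rewrite !inE.
have Ad_out n (x : subgp (Gs n)) : i != n -> Ad g n x = x.
  by move=> ni; rewrite /Ad dfwith_out.
have innerE x : inner (val g)^-1 x = x ^ (val g)^-1 by [].
case/or4P=> /eqP-> x; rewrite [RHS]autME factor_autE innerE.
- rewrite /Ad dfwith_in -[inner g x]/(g^-1 * (x * g)).
  rewrite !subgpM subgpV -/(conjg _ _) conjgK.
  apply: aut_mul3; first exact: (pconj_id fs g x ij).
    exact: (pconj_id fs g x ik).
  exact: (pconj_id fs g x il).
- rewrite (Ad_out _ _ ij); apply: aut_mul3; first exact: pconj_act.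
    exact: (pconj_idJ fs g g x jk ik).
  exact: (pconj_idJ fs g g x jl il).
- rewrite (Ad_out _ _ ik); apply: aut_mul3; first exact: (pconj_id fs g x kj).
    exact: pconj_act.
  exact: (pconj_idJ fs g g x kl il).
- rewrite (Ad_out _ _ il); apply: aut_mul3; first exact: (pconj_id fs g x lj).
    exact: (pconj_id fs g x lk).
  exact: pconj_act.
Qed.

Lemma relations_out_eval w : relations (fs := fs) w -> out_eval fs w = 1.
Proof.
have commR (a b : fprodg (gen_group fs)) x y : out_eval fs a = out_class x ->
    out_eval fs b = out_class y -> commute x y -> out_eval fs [~ a, b] = 1.
  move=> ax bx xy; rewrite gmulfR ax bx; apply/eqP/commgP.
  exact: gmulf_commute.
case=> [i j k l ij ik g h /set4_full u|i j k l ij kl g h /set4_full u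
       |i j k l ij ik il g /set4_full u|i j k l ij g phi _].
- apply: (commR); rewrite ?out_eval_f //; apply: pconj_commute => //.
  by move: u; rewrite /= !inE !negb_or -!andbA => /and5P[].
- move: u; rewrite /= !inE !negb_or -!andbA => /and5P[_ _ il jk /andP[jl _]].
  by apply: (commR); rewrite ?out_eval_f //; apply: pconj_commute; rewrite // eq_sym.
- have homE (H : groupType) (h : {hom fprodg (gen_group fs) -> H}) a b c d :
    h (a * b * c / d) = h a * h b * h c / h d by rewrite gmulfF !gmulfM.
  rewrite homE !out_eval_f out_eval_Phi.
  apply: (canLR (mulgK _)); rewrite mul1g.
  have := congr1 (@out_class G) (pconj_Ad g u).
  by rewrite 3!gmulfM => ->; rewrite -[X in _ * X]/(out_class _) out_class_inner mulg1.
have homE (H : groupType) (h : {hom fprodg (gen_group fs) -> H}) a b d :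
  h (a^-1 * b * a / d) = h b ^ h a / h d.
  by rewrite gmulfF !gmulfM gmulfV conjgE !mulgA.
rewrite homE !out_eval_f out_eval_Phi.
apply: (canLR (mulgK _)); rewrite mul1g -(pconj_factor_aut fs j g phi).
exact/esym/gmulfJ.
Qed.

(** * The generators and their relations in the presented group *)

Local Notation P := (quot (ncl (relations (fs := fs)))).

Definition pres_f i (j : 'I_4) (x : subgp (Gs i)) : P :=
  if pselect (i != j) is left ij then quot_pi _ (gen_f fs ij x) else 1.

Definition pres_Phi (phi : Phi Gs) : P := quot_pi _ (gen_Phi fs phi).

Lemma pres_fE i j (ij : i != j) (x : subgp (Gs i)) :
  pres_f j x = quot_pi _ (gen_f fs ij x).
Proof.
rewrite /pres_f; case: pselect => [ij'|//].
by rewrite (bool_irrelevance ij' ij).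
Qed.

Lemma pres_f_diag i (x : subgp (Gs i)) : pres_f i x = 1.
Proof. by rewrite /pres_f; case: pselect => // ii; case/eqP: (ii). Qed.

Lemma pres_fM i j : {morph (@pres_f i j) : x y / x * y}.
Proof.
move=> x y; have [<-|ij] := eqVneq i j; first by rewrite !pres_f_diag mulg1.
rewrite !(pres_fE ij) -gmulfM; congr (quot_pi _ _).
rewrite /gen_f -gmulfM; congr fprodg_in; apply: val_inj.
by rewrite subgpM /= gmulfM.
Qed.

Lemma pres_PhiM : {morph pres_Phi : x y / x * y}.
Proof. by move=> x y; rewrite /pres_Phi /gen_Phi !gmulfM. Qed.

Lemma pres_rel w : relations (fs := fs) w -> quot_pi _ w = 1 :> P.
Proof.
by move=> Rw; apply/eq_quotP; rewrite invg1 mulg1; apply/asboolP/ncl_gen.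
Qed.

(** Relations are indexed by all four indices, so a relation that mentions fewer of them needs a
    completion. *)
Lemma ex_quad3 (i j k : 'I_4) : uniq [:: i; j; k] -> exists l, uniq [:: i; j; k; l].
Proof.
move=> u; have [|l ls] := @ex_notin 'I_4 [:: i; j; k]; first by rewrite card_ord.
by exists l; rewrite -(rotr_uniq 1) /rotr /= ls.
Qed.

Lemma pres_f_commute i j k (x y : subgp (Gs i)) : j != k ->
  commute (pres_f j x) (pres_f k y).
Proof.
move=> jk; have [<-|ij] := eqVneq i j.
  by rewrite pres_f_diag; apply/commute_sym/commute1.
have [<-|ik] := eqVneq i k; first by rewrite pres_f_diag; apply: commute1.
have [l u] : exists l, uniq [:: i; j; k; l].
  by apply: ex_quad3; rewrite /= !inE negb_or ij ik jk.
rewrite (pres_fE ij) (pres_fE ik); apply/commgP/eqP; rewrite -gmulfR.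
by apply/pres_rel/rel1/set4_full; exact: u.
Qed.

Lemma pres_f_commute4 i j k l (x : subgp (Gs i)) (y : subgp (Gs k)) :
  uniq [:: i; j; k; l] -> commute (pres_f j x) (pres_f l y).
Proof.
move=> u; have : i != j /\ k != l.
  by move: u; rewrite /= !inE !negb_or -!andbA => /and5P[-> _ _ _ /and3P[_ ->]].
case=> ij kl; rewrite (pres_fE ij) (pres_fE kl); apply/commgP/eqP.
by rewrite -gmulfR; apply/pres_rel/rel2/set4_full.
Qed.

Lemma pres_f_Ad i (x : subgp (Gs i)) : \prod_j pres_f j x = pres_Phi (Ad x).
Proof.
have -> : \prod_j pres_f j x = \prod_(j | j != i) pres_f j x.
  rewrite [RHS]big_mkcond; apply: eq_bigr => j _.
  by case: eqVneq => // ->; rewrite pres_f_diag.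
rewrite -big_filter; set s := filter _ _.
have us : uniq (i :: s) by rewrite /= mem_filter eqxx filter_uniq // index_enum_uniq.
have ss : size s = 3.
  rewrite size_filter -/(index_enum _) -sum1_count sum1_card.
  by have := cardC1 i; rewrite card_ord.
move: us ss; case: s => [|j [|k [|l [|//]]]] // u _.
rewrite !big_cons big_nil mulg1.
have [ij ik il] : [/\ i != j, i != k & i != l].
  by move: u; rewrite /= !inE !negb_or -!andbA => /and4P[-> -> ->].
rewrite (pres_fE ij) (pres_fE ik) (pres_fE il) mulgA -!gmulfM.
apply: divg1_eq; rewrite -gmulfF; apply/pres_rel/rel3/set4_full; exact: u.
Qed.

Lemma pres_fJ i j (x : subgp (Gs i)) phi :
  pres_f j x ^ pres_Phi phi = pres_f j (phi i x).
Proof.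
have [<-|ij] := eqVneq i j; first by rewrite !pres_f_diag conj1g.
have [k u3] : exists k, uniq [:: i; j; k].
  have [|k ks] := @ex_notin 'I_4 [:: i; j]; first by rewrite card_ord.
  exists k; move: ks; rewrite /= !inE !negb_or ij eq_sym [k == j]eq_sym.
  by case/andP=> -> ->.
have [l u] := ex_quad3 u3.
rewrite !(pres_fE ij) -gmulfJ; apply: divg1_eq; rewrite -gmulfF.
by rewrite conjgE mulgA; apply: pres_rel; apply: rel4; apply/set4_full; exact: u.
Qed.

End Relations.

(** * The isomorphism *)

Section Evaluation.
Variables (G : groupType) (Gs : 'I_4 -> groupClosed G).
Hypothesis fs : free_splitting Gs.
Hypothesis nontrivial : forall i, exists2 x, x \in Gs i & x != 1.

Local Notation P := (quot (ncl (relations (fs := fs)))).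
Local Notation whitehead := (whitehead (@pres_f _ _ fs)).
Local Notation descent := (descent fs (@pres_f _ _ fs) (@pres_Phi _ _ fs)).

Lemma relations_lift w :
  relations (fs := fs) w -> fprodg_lift (gen_hom fs) w = 1.
Proof. by move=> /relations_out_eval Rw; apply: val_inj; rewrite val1. Qed.

Definition pres_eval : {hom P -> OutS Gs} :=
  quot_lift (phi := fprodg_lift (gen_hom fs)) relations_lift.

Definition pres_out : {hom P -> Out G} := incl (pure_sym Gs) \o pres_eval.

Lemma pres_out_pi w : pres_out (quot_pi _ w) = out_eval fs w.
Proof. exact: (congr1 val (quot_liftE relations_lift w)). Qed.

Lemma pres_out_f i j (ij : i != j) (x : subgp (Gs i)) :
  pres_out (pres_f fs j x) = out_class (pconj fs j x).
Proof. by rewrite (pres_fE fs ij) pres_out_pi out_eval_f. Qed.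

Lemma pres_out_Phi phi :
  pres_out (pres_Phi fs phi) = out_class (factor_aut fs phi).
Proof. by rewrite pres_out_pi out_eval_Phi. Qed.

Lemma whitehead_aut i (u : 'I_4 -> subgp (Gs i)) :
  exists2 c : aut G, pres_out (whitehead u) = out_class c &
    forall j (x : subgp (Gs j)),
      c (val x) = if j == i then val x else val x ^ (val (u j))^-1.
Proof.
(* The claim is generalised to partial products over a list without repetition, for induction on the
   list. *)
suff [c ce cE] : exists2 c : aut G,
    pres_out (\prod_(j <- index_enum 'I_4) pres_f fs j (u j)) = out_class c &
    forall j (x : subgp (Gs j)),
      c (val x) = if (j \in index_enum 'I_4) && (j != i)
                  then val x ^ (val (u j))^-1 else val x.
  exists c; first exact: ce.
  by move=> j x; rewrite cE mem_index_enum; case: eqVneq.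
elim: (index_enum 'I_4) (index_enum_uniq 'I_4) => [_|k s IHs].
  by exists 1; rewrite ?big_nil ?gmulf1 // => j x; rewrite aut1E.
rewrite cons_uniq => /andP[ks /IHs[c ce cE]]; rewrite big_cons gmulfM ce.
have [->|ki] := eqVneq k i.
  exists c; first by rewrite pres_f_diag gmulf1 mul1g.
  by move=> j x; rewrite cE inE; case: eqVneq; rewrite ?andbF.
exists (pconj fs k (u k) * c).
  by rewrite pres_out_f 1?eq_sym // gmulfM.
move=> j x; rewrite autME inE; have [jk|jk] := eqVneq j k; last first.
  by rewrite pconj_id // cE.
move: x; rewrite jk ki => x.
by rewrite pconj_act autJ aut_funV !cE (negPf ks) eqxx andbF.
Qed.

Definition realizes (b : aut G) (t : 'I_4 -> G) :=
  forall i (x : subgp (Gs i)), b (val x) = val x ^ t i.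

(** Composing with the Whitehead automorphism cancels the factor [fst_syl i j t ^ t i] by which the
    gate moves the [j]-th entry. *)
Lemma descent_aut t q : descent t q ->
  exists2 b : aut G, pres_out q = out_class b & realizes b t.
Proof.
elim=> {t q} [a g|i t q _ _ [b qb bt]].
  exists (factor_aut fs (Ads a) * inner g).
    by rewrite pres_out_Phi gmulfM /= out_class_inner mulg1.
  move=> i x; rewrite autME factor_autE /twist conjgM.
  by rewrite -[inner g _]/(_ ^ _) -[Ads a i x]/(x ^ a i) gmulfJ.
have [c ec cE] := whitehead_aut (fun j => fst_syl fs i j t).
exists (c * b); first by rewrite gmulfM ec qb gmulfM.
move=> j x; rewrite autME cE; case: eqVneq => [ji|ji].
  by rewrite bt; congr (_ ^ _); rewrite gateE ji eqxx.
rewrite autJ aut_funV !bt !gateE eqxx (negPf ji) -conjgM.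
by rewrite mulgK.
Qed.

Lemma descent_pres_unique t q q' :
  generating Gs t -> descent t q -> descent t q' -> q = q'.
Proof.
move=> tg; apply: descent_unique => //.
- exact: pres_f_diag.
- exact: pres_fM.
- exact: pres_PhiM.
- exact: pres_f_commute.
- exact: pres_f_commute4.
- exact: pres_f_Ad.
- exact: pres_fJ.
Qed.

(** Left multiplication by a generator corresponds to the inverse move on tuples, by [descent_mv]
    and [mvK]. *)
Lemma descent_pres_mv i j (x : subgp (Gs i)) t q : i != j ->
  generating Gs t -> descent t q ->
  exists t', generating Gs t' /\ descent t' (pres_f fs j x * q).
Proof.
move=> ij tg dq; exists (mv (fun k => (single j x k)^-1) t).
have tg' : generating Gs (mv (fun k => (single j x k)^-1) t).
  exact: generating_mv.
split=> //; rewrite -(whitehead_single (pres_fM fs)).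
apply: descent_mv => //; try exact: pres_f_diag.
- exact: pres_fM.
- exact: pres_PhiM.
- exact: pres_f_commute.
- exact: pres_f_Ad.
- exact: pres_fJ.
- by rewrite mvK => q1 q2; apply: descent_pres_unique.
- by rewrite mvK.
Qed.

Lemma generating1 : generating Gs (fun=> 1).
Proof.
elim/(splitting_ind fs) => [|i x g xG gg]; first exact: gen1.
by have := genM (t := fun=> 1) xG gg; rewrite /= conjg1.
Qed.

(** By induction on words: a letter of [Phi] joins [phi], and a letter of [Gsub] passes [phi] by
    relation 4 and is absorbed into the descent. *)
Lemma pres_decomposition (r : P) : exists phi t q,
  [/\ r = pres_Phi fs phi * q, generating Gs t & descent t q].
Proof.
have [w ->] : exists w, r = quot_pi _ w.
  by exists (repr r); rewrite /quot_pi reprK.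
elim/fprodg_ind: w => [|a y w [phi [t [q [wq tg dq]]]]].
  exists 1, (fun=> 1), (pres_Phi fs (Ads (fun k => 1 : subgp (Gs k)))).
  split; last 2 first.
  - exact: generating1.
  - rewrite (_ : (fun=> 1) = twist (fun k => 1 : subgp (Gs k)) (fun=> 1)).
      exact: descent_base.
    by apply/funext => k; rewrite /twist mulg1.
  rewrite -pres_PhiM mul1g (_ : Ads _ = 1).
    by rewrite /pres_Phi /gen_Phi !gmulf1.
  by apply: functional_extensionality_dep => k; rewrite /Ads gmulf1.
have -> : quot_pi (ncl (relations (fs := fs))) (fprodg_in y * w) =
  quot_pi _ (fprodg_in y) * quot_pi _ w by exact: gmulfM.
rewrite {}wq; case: a y => [[[i j] /= ij]|] y; last first.
  by exists (y * phi), t, q; split; rewrite // pres_PhiM mulgA.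
have [x ->] : exists x, y = himg_in (f_ fs ij) x.
  by have /asboolP[x yx] := valP y; exists x; apply: val_inj.
have [t' [tg' dq']] := descent_pres_mv (phi i x) ij tg dq.
exists phi, t', (pres_f fs j (phi i x) * q); split=> //.
rewrite -[fprodg_in _]/(gen_f fs ij x) -(pres_fE fs ij) !mulgA.
by congr (_ * q); rewrite -(pres_fJ fs) -conjgC.
Qed.

(** If the image of [pres_Phi fs phi * q] is inner, the tuple is a twist of a constant one.
    Uniqueness of descents then puts [q] in the image of [Phi], where it cancels [phi]. *)
Lemma pres_eval_inj : injective pres_eval.
Proof.
apply: gmulf_inj => r; have [phi [t [q [-> tg dq]]]] := pres_decomposition r.
have [b qb bt] := descent_aut dq.
move=> /(congr1 val); rewrite val1.
rewrite -[LHS]/(pres_out _) gmulfM qb pres_out_Phi -gmulfM.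
move=> /out_class_eq1[g eg].
have phit i (x : subgp (Gs i)) : val (phi i x) ^ t i = val x ^ g.
  by rewrite -bt -factor_autE -autME eg.
(* Conjugation by [t i / g] keeps a nontrivial element of [Gs i] inside [Gs i], so
   self-normalization applies. *)
have tgi i : t i / g \in Gs i.
  have [x xG x1] := nontrivial i.
  have := phit i ((phi i)^-1 (Subgp xG)); rewrite autVK /= => e.
  apply: (self_normalizing fs xG x1); rewrite conjgM e conjgK.
  exact: val_in.
pose a i : subgp (Gs i) := Subgp (tgi i).
have ta : t = twist a (fun=> g).
  by apply/funext => i; rewrite /twist /= mulgVK.
rewrite ta in tg dq.
rewrite (descent_pres_unique tg dq (descent_base _ _ _ a g)).
rewrite -pres_PhiM (_ : phi * Ads a = 1).
  by rewrite /pres_Phi /gen_Phi !gmulf1.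
apply: functional_extensionality_dep => i; apply: aut_eq => x.
apply: val_inj; rewrite -[LHS]/(val (phi i x ^ a i)) gmulfJ /=.
by rewrite conjgM phit conjgK.
Qed.

(** A representative [d] splits as a factor automorphism followed by conjugations by [t i]. Its
    surjectivity makes [t] generating, and a descent from [t] realizes the second part. *)
Lemma pres_eval_surj (c : OutS Gs) : exists r, pres_eval r = c.
Proof.
have /asboolP[d dc dP] := valP c.
have [t tP] := choice dP.
have [phi phiE] : exists phi : Phi Gs, forall i (x : subgp (Gs i)),
    d (val x) = val (phi i x) ^ t i.
  suff phiP : forall i, exists a : aut (subgp (Gs i)),
    forall x : subgp (Gs i), d (val x) = val (a x) ^ t i.
    by exists (fun i => sval (cid (phiP i))) => i; apply: svalP (cid (phiP i)).
  move=> i.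
  have im (x : subgp (Gs i)) : d (val x) ^ (t i)^-1 \in Gs i.
    have : (d @` [set` Gs i])%classic (d (val x)).
      by exists (val x) => //; apply: val_in.
    by rewrite tP => -[y yG <-]; rewrite conjgK.
  (* The reverse inclusion of [Gs i ^ t i] in the image of [Gs i] provides the inverse of the factor
     automorphism. *)
  have pre (x : subgp (Gs i)) : d^-1 (val x ^ t i) \in Gs i.
    have : ((fun x => x ^ t i) @` [set` Gs i])%classic (val x ^ t i).
      by exists (val x) => //; apply: val_in.
    by rewrite -tP => -[y yG <-]; rewrite autK.
  pose s (x : subgp (Gs i)) : subgp (Gs i) := Subgp (im x).
  pose s' (x : subgp (Gs i)) : subgp (Gs i) := Subgp (pre x).
  have sM : {morph s : x y / x * y}.
    move=> x y; apply: val_inj; rewrite [RHS]subgpM.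
    by rewrite -[LHS]/(d (val (x * y)) ^ (t i)^-1) subgpM aut_funM conjMg.
  have sK : cancel s s'.
    move=> x; apply: val_inj.
    by rewrite -[LHS]/(d^-1 ((d (val x) ^ (t i)^-1) ^ t i)) conjgKV autK.
  have s'K : cancel s' s.
    move=> x; apply: val_inj.
    by rewrite -[LHS]/(d (d^-1 (val x ^ t i)) ^ (t i)^-1) autVK conjgK.
  by exists (Aut sM sK s'K) => x; rewrite /= conjgKV.
have tg : generating Gs t.
  move=> g; rewrite -[g](autVK d).
  elim/(splitting_ind fs): (d^-1 g) => [|i x h xG hg].
    by rewrite gmulf1; apply: gen1.
  rewrite aut_funM -[x]/(val (Subgp xG : subgp (Gs i))) phiE.
  by apply: genM hg; apply: val_in.
have [q dq] := descent_ex fs nontrivial (@pres_f _ _ fs) (@pres_Phi _ _ fs) tg.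
have [b qb bt] := descent_aut dq.
exists (pres_Phi fs phi * q); apply: val_inj; rewrite -dc.
rewrite -[LHS]/(pres_out _) gmulfM pres_out_Phi qb -gmulfM; congr out_class.
apply: (aut_splitting_eq fs) => i x.
by rewrite autME factor_autE bt phiE.
Qed.

End Evaluation.

Theorem theorem4p2p2 (G : groupType) (Gs : 'I_4 -> groupClosed G)
    (fs : free_splitting Gs)
    (nontrivial : forall i, exists2 x, x \in Gs i & x != 1) :
  generated_subject_to (gen_hom fs) (relations (fs := fs)).
Proof.
exists (pres_eval fs); split=> [w|]; first exact: quot_liftE.
have [g gK] := choice (pres_eval_surj fs nontrivial).
exists g => // r; apply: (pres_eval_inj nontrivial); exact: gK.
Qed.
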